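(* Let $A$ be an associative conformal algebra. The cup product $\sqcup$ on the Hochschild cochains $\bigoplus_{i\ge0}\mathcal C^i(A,A)$ induces a well-defined product, also denoted $\sqcup$, on $\bigoplus_{i\ge0}\mathrm{HH}^i(A)$ such that $\big(\bigoplus_{i\ge0}\mathrm{HH}^i(A),\sqcup\big)$ is a graded associative algebra.
   Context: Base field: $\mathbb C$ denotes a fixed algebraically closed field of characteristic zero; all vector spaces, linear maps and tensor products are over $\mathbb C$. For a vector space $V$, $V[\lambda_1,\dots,\lambda_k]$ is the space of polynomials in $\lambda_1,\dots,\lambda_k$ with coefficients in $V$. All operations are extended coefficientwise to polynomial-valued arguments. Graded associative algebras are not required to have a unit. Associative conformal algebra: a $\mathbb C[\partial]$-module $A$ with a bilinear map $A\times A\to A[\lambda]$, $(a,b)\mapsto a_{(\lambda)}b$, such that for all $a,b,c\in A$: $(\partial a)_{(\lambda)}b=-\lambda\, a_{(\lambda)}b$, $a_{(\lambda)}(\partial b)=(\partial+\lambda)(a_{(\lambda)}b)$, $(a_{(\lambda)}b)_{(\lambda+\mu)}c=a_{(\lambda)}(b_{(\mu)}c)$. If $a_{(\lambda)}b=\sum_k\lambda^kc_k$, then $a_{(-\partial)}b:=\sum_k(-\partial)^kc_k$. Hochschild complex: $\mathcal C^0(A,A)=A/\partial A$, $\mathcal C^1(A,A)=\mathrm{Hom}_{\mathbb C[\partial]}(A,A)$, and for $n\ge2$, $\mathcal C^n(A,A)$ is the space of conformal sesquilinear maps, i.e. linear maps $\varphi:A^{\otimes n}\to A[\lambda_1,\dots,\lambda_{n-1}]$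 with $\varphi_{\lambda_1,\dots,\lambda_{n-1}}(a_1,\dots,\partial a_i,\dots,a_n)=-\lambda_i\varphi_{\lambda_1,\dots,\lambda_{n-1}}(a_1,\dots,a_n)$ for $1\le i\le n-1$, and $\varphi_{\lambda_1,\dots,\lambda_{n-1}}(a_1,\dots,a_{n-1},\partial a_n)=(\partial+\lambda_1+\dots+\lambda_{n-1})\varphi_{\lambda_1,\dots,\lambda_{n-1}}(a_1,\dots,a_n)$. Differentials: $d_0(v+\partial A)(a)=a_{(-\partial)}v-v_{(0)}a$, and for $n\ge1$ $$d_n(\varphi)_{\lambda_1,\dots,\lambda_n}(a_1,\dots,a_{n+1})=a_1{}_{(\lambda_1)}\varphi_{\lambda_2,\dots,\lambda_n}(a_2,\dots,a_{n+1})+\sum_{i=1}^n(-1)^i\varphi_{\lambda_1,\dots,\lambda_{i-1},\lambda_i+\lambda_{i+1},\lambda_{i+2},\dots,\lambda_n}(a_1,\dots,a_{i-1},a_i{}_{(\lambda_i)}a_{i+1},a_{i+2},\dots,a_{n+1})+(-1)^{n+1}\varphi_{\lambda_1,\dots,\lambda_{n-1}}(a_1,\dots,a_n)_{(\lambda_1+\dots+\lambda_n)}a_{n+1}.$$ (In the term $i=n$, where the product is in the last argument, the subscript of $\varphi$ is $\lambda_1,\dots,\lambda_{n-1}$.) One has $d_{n+1}\circ d_n=0$; $\mathrm{HH}^n(A)=\ker d_n/\mathrm{im}\, d_{n-1}$ for $n\ge1$ and $\mathrm{HH}^0(A)=\ker d_0$. Cup product: for $f\in\mathcal C^m(A,A)$,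 $g\in\mathcal C^n(A,A)$, $m,n\ge1$, $$(f\sqcup g)_{\lambda_1,\dots,\lambda_{m+n-1}}(a_1,\dots,a_{m+n})=f_{\lambda_1,\dots,\lambda_{m-1}}(a_1,\dots,a_m)_{(\lambda_1+\dots+\lambda_m)}g_{\lambda_{m+1},\dots,\lambda_{m+n-1}}(a_{m+1},\dots,a_{m+n}).$$ For $b\in\mathcal C^0(A,A)=A/\partial A$ (evaluated on any representative in $A$): $(b\sqcup g)_{\lambda_1,\dots,\lambda_{n-1}}(a_1,\dots,a_n)=b_{(0)}g_{\lambda_1,\dots,\lambda_{n-1}}(a_1,\dots,a_n)$ and $(f\sqcup b)_{\lambda_1,\dots,\lambda_{m-1}}(a_1,\dots,a_m)=f_{\lambda_1,\dots,\lambda_{m-1}}(a_1,\dots,a_m)_{(-\partial)}b$; for $b,b'\in A/\partial A$, $b\sqcup b'$ is the class of $b_{(0)}b'$ in $A/\partial A$. *)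

(* Defs.v *)
From HB Require Import structures.
From mathcomp Require Import all_boot all_order all_algebra.
From mathcomp Require Import finmap boolp functions.
From mathcomp.multinomials Require Import monalg.

Set Implicit Arguments.
Unset Strict Implicit.
Unset Printing Implicit Defensive.

Import GRing.Theory.
Local Open Scope ring_scope.

Section LinearFunctions.
Variables (R : pzRingType) (U W : lmodType R) (f : U -> W).
Hypothesis f_linear : linear f.

Lemma linear_fun0 : f 0 = 0.
Proof.
by have := f_linear (-1) 0 0; rewrite scaler0 addr0 scaleN1r addNr.
Qed.

Lemma linear_funD : {morph f : u v / u + v}.
Proof. by move=> u v; have := f_linear 1 u v; rewrite !scale1r. Qed.

Lemma linear_funN : {morph f : u / - u}.
Proof.
move=> u; have := f_linear (-1) u 0.
by rewrite !scaleN1r linear_fun0 !addr0.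
Qed.

End LinearFunctions.

(** * Polynomials with coefficients in a vector space *)

(** [vpoly V k] is V[λ_0, ..., λ_(k-1)]: the coefficient of the monomial [m] of
    [P] is [P@_m]. For [k = 0] there is only the monomial 1. *)
Definition vpoly (C : fieldType) (V : lmodType C) (k : nat) : Type :=
  {malg V['X_{1..k}]}.

(** C[λ_0, ..., λ_(k-1)] *)
Notation spoly C k := {malg C['X_{1..k}]}.

(* Several definitions are locked because unification is very slow when it may
   unfold [<< _ *g _ >>]. *)

(** The variable λ_i. *)
HB.lock Definition svar (C : fieldType) (k : nat) (i : 'I_k) : spoly C k :=
  << ucm i >>.
Canonical svar_unlockable := Unlockable svar.unlock.

(** The monomial [m] with coefficient [v]. *)
HB.lock Definition vmonom (C : fieldType) (V : lmodType C) (k : nat)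
    (m : 'X_{1..k}) (v : V) : vpoly V k := << v *g m >>.
Canonical vmonom_unlockable := Unlockable vmonom.unlock.

(** The additive map from V[λ] to [W] that sends [vmonom m v] to [F m v]. *)
HB.lock Definition vpext (C : fieldType) (V : lmodType C) (k : nat)
    (W : nmodType) (F : 'X_{1..k} -> V -> W) (P : vpoly V k) : W :=
  \sum_(m <- msupp P) F m P@_m.
Canonical vpext_unlockable := Unlockable vpext.unlock.

Section VpolyModule.
Variables (C : fieldType) (V : lmodType C) (k : nat).

HB.instance Definition _ := GRing.Zmodule.on (vpoly V k).

Lemma vmonomE m (v : V) (m' : 'X_{1..k}) :
  (vmonom m v)@_m' = v *+ (m == m').
Proof. by rewrite [vmonom]unlock mcoeffU. Qed.

Definition vpscale (c : C) (P : vpoly V k) : vpoly V k :=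
  vpext (fun m v => vmonom m (c *: v)) P.

Lemma vpscaleE c P m : (vpscale c P)@_m = c *: P@_m.
Proof.
rewrite /vpscale [vpext]unlock raddf_sum /=.
under eq_bigr do rewrite vmonomE.
have [mP|mP] := boolP (m \in msupp P); last first.
  rewrite mcoeff_outdom // scaler0 big_seq big1 // => i iP.
  by case: eqP iP => // ->; rewrite (negPf mP).
rewrite (big_fsetD1 m) //= eqxx big_seq big1 ?addr0 // => i.
by rewrite in_fsetD1; case: eqP.
Qed.

Fact vpscaleA a b P : vpscale a (vpscale b P) = vpscale (a * b) P.
Proof. by apply/malgP => m; rewrite !vpscaleE scalerA. Qed.

Fact vpscale1 : left_id 1 vpscale.
Proof. by move=> P; apply/malgP => m; rewrite vpscaleE scale1r. Qed.

Fact vpscaleDr : right_distributive vpscale +%R.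
Proof.
by move=> a P Q; apply/malgP => m; rewrite mcoeffD !vpscaleE mcoeffD scalerDr.
Qed.

Fact vpscaleDl P : {morph vpscale^~ P : a b / a + b}.
Proof. by move=> a b; apply/malgP => m; rewrite mcoeffD !vpscaleE scalerDl. Qed.

HB.instance Definition _ := GRing.Zmodule_isLmodule.Build C (vpoly V k)
  vpscaleA vpscale1 vpscaleDr vpscaleDl.

Lemma vcoeffZ c (P : vpoly V k) m : (c *: P)@_m = c *: P@_m.
Proof. exact: vpscaleE. Qed.

Lemma vmonom_linear m : linear (@vmonom C V k m).
Proof.
move=> c u v; apply/malgP => m'.
by rewrite mcoeffD vcoeffZ !vmonomE mulrnDl scalerMnr.
Qed.

Lemma vpolyE (P : vpoly V k) : P = \sum_(m <- msupp P) vmonom m P@_m.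
Proof. by rewrite [vmonom]unlock; apply: monalgE. Qed.

End VpolyModule.

Section VpextLinear.
Variables (C : fieldType) (V : lmodType C) (k : nat) (W : lmodType C).
Variable F : 'X_{1..k} -> V -> W.
Hypothesis F_linear : forall m, linear (F m).

Lemma vpextEw (D : {fset 'X_{1..k}}) (P : vpoly V k) :
  (msupp P `<=` D)%fset -> vpext F P = \sum_(m <- D) F m P@_m.
Proof.
move=> sPD; rewrite [vpext]unlock; apply: big_fset_incl => // m _ /mcoeff_outdom ->.
exact: linear_fun0.
Qed.

Lemma vpext_linear : linear (vpext F : vpoly V k -> W).
Proof.
move=> c P Q; set D := (msupp (c *: P + Q) `|` (msupp P `|` msupp Q))%fset.
rewrite !(@vpextEw D) /D ?fsubsetUl //; first last.
- by rewrite fsubsetU // fsubsetUl orbT.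
- by rewrite fsubsetU // fsubsetUr orbT.
rewrite scaler_sumr -big_split /=; apply: eq_bigr => m _.
by rewrite mcoeffD vcoeffZ F_linear.
Qed.

End VpextLinear.

Section VpolyOperations.
Variables (C : fieldType) (V : lmodType C).

(** The element p·v of V[λ], for p in C[λ] and v in V. *)
Definition vtens (k : nat) (p : spoly C k) (v : V) : vpoly V k :=
  \sum_(m <- msupp p) vmonom m (p@_m *: v).

(** The product of P in V[λ] by the monomial [q]. *)
Definition vshift (k : nat) (q : 'X_{1..k}) (P : vpoly V k) : vpoly V k :=
  vpext (fun m v => vmonom (mmul q m) v) P.

(** The action of C[λ] on V[λ]. *)
Definition vmul (k : nat) (p : spoly C k) (P : vpoly V k) : vpoly V k :=
  \sum_(q <- msupp p) p@_q *: vshift q P.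

(** The substitution λ_i := s i. *)
Definition vsubst (k l : nat) (s : 'I_k -> spoly C l) (P : vpoly V k) :
    vpoly V l :=
  vpext (fun m v => vtens (\prod_(i < k) s i ^+ m i) v) P.

(** The coefficientwise extension of a linear map. *)
Definition vmap (k : nat) (f : V -> V) (P : vpoly V k) : vpoly V k :=
  vpext (fun m v => vmonom m (f v)) P.

Lemma vtens_linear k (p : spoly C k) : linear (vtens p).
Proof.
move=> c u v; rewrite /vtens scaler_sumr -big_split /=.
apply: eq_bigr => m _; rewrite -vmonom_linear; congr vmonom.
by rewrite scalerDr !scalerA mulrC.
Qed.

Lemma vshift_linear k q : linear (@vshift k q).
Proof. by apply: vpext_linear => m; apply: vmonom_linear. Qed.

Lemma vmul_linear k p : linear (@vmul k p).
Proof.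
move=> c P Q; rewrite /vmul scaler_sumr -big_split /=.
apply: eq_bigr => m _.
by rewrite vshift_linear scalerDr !scalerA mulrC.
Qed.

Lemma vmap_linear k (f : {linear V -> V}) : linear (@vmap k f).
Proof. by apply: vpext_linear => m c u v; rewrite linearP vmonom_linear. Qed.

Lemma vsubst_linear k l s : linear (@vsubst k l s).
Proof. by apply: vpext_linear => m; apply: vtens_linear. Qed.

End VpolyOperations.

(** * Associative conformal algebras *)

Section LambdaProduct.
Variables (C : fieldType) (V : lmodType C) (D : V -> V).
Variable lprod : V -> V -> vpoly V 1.

(** [lprod_at l a b] is a_(l) b in V[λ], for a polynomial l in C[λ]. *)
Definition lprod_at (k : nat) (l : spoly C k) (a b : V) : vpoly V k :=
  vsubst (fun _ : 'I_1 => l) (lprod a b).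

(** P_(l) Q for P, Q in V[λ], by coefficientwise extension. *)
Definition lprod_ext (k : nat) (l : spoly C k) (P Q : vpoly V k) :
    vpoly V k :=
  vpext (fun m a => vpext (fun m' b =>
    vshift (mmul m m') (lprod_at l a b)) Q) P.

(** a_(0) b *)
Definition lprod0 (a b : V) : V := (lprod a b)@_mone.

(** a_(-∂) b *)
Definition lprodND (a b : V) : V :=
  vpext (fun m c => iter (m ord0) (fun x => - D x) c) (lprod a b).

End LambdaProduct.

Section LambdaProductLinear.
Variables (C : fieldType) (V : lmodType C) (lprod : V -> V -> vpoly V 1).
Hypothesis lprod_linearl : forall b, linear (lprod^~ b).
Hypothesis lprod_linearr : forall a, linear (lprod a).

Lemma vpextP (k : nat) (U W : lmodType C) (F G H : 'X_{1..k} -> U -> W) c P :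
  (forall m u, F m u = c *: G m u + H m u) ->
  vpext F P = c *: vpext G P + vpext H P.
Proof.
move=> FE; rewrite [vpext]unlock scaler_sumr -big_split /=.
by apply: eq_bigr => m _; apply: FE.
Qed.

Lemma lprod_ext_linearr k l (P : vpoly V k) : linear (lprod_ext lprod l P).
Proof.
move=> c Q Q'; apply: vpextP => m a; apply: vpext_linear => m' d u v.
by rewrite /lprod_at lprod_linearr vsubst_linear vshift_linear.
Qed.

Lemma lprod_ext_linearl k l (Q : vpoly V k) : linear ((lprod_ext lprod l)^~ Q).
Proof.
apply: vpext_linear => m c u v; apply: vpextP => m' b.
by rewrite /lprod_at lprod_linearl vsubst_linear vshift_linear.
Qed.

Lemma lprodND_linearr (D : {linear V -> V}) a : linear (lprodND D lprod a).
Proof.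
move=> c u v; rewrite /lprodND lprod_linearr; apply: vpext_linear => m d x y.
by elim: (m ord0) => //= n ->; rewrite linearP opprD scalerN.
Qed.

Lemma lprod0_linearl b : linear ((lprod0 lprod)^~ b).
Proof. by move=> c u v; rewrite /lprod0 lprod_linearl mcoeffD vcoeffZ. Qed.

End LambdaProductLinear.

Record confAlgType (C : fieldType) := ConfAlg {
  confAlg_sort :> lmodType C;
  cder : {linear confAlg_sort -> confAlg_sort};
  cprod : confAlg_sort -> confAlg_sort -> vpoly confAlg_sort 1;
  cprod_linearl : forall b, linear (cprod^~ b);
  cprod_linearr : forall a, linear (cprod a);
  cprod_derl : forall a b,
    cprod (cder a) b = vmul (- svar C ord0) (cprod a b);
  cprod_derr : forall a b,
    cprod a (cder b) = vmap cder (cprod a b) + vmul (svar C ord0) (cprod a b);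
  (* (a_(λ) b)_(λ+μ) c = a_(λ) (b_(μ) c), with λ = λ_0 and μ = λ_1 *)
  cprodA : forall a b c,
    let lam : spoly C 2 := svar C ord0 in
    let mu : spoly C 2 := svar C ord_max in
    lprod_ext cprod (lam + mu) (lprod_at cprod lam a b) (vmonom mone c) =
    lprod_ext cprod lam (vmonom mone a) (lprod_at cprod mu b c)
}.

(** * Quotients and direct sums of vector spaces *)

Section QuotientModule.
Variables (R : pzRingType) (V : lmodType R) (W : submodClosed V).

Definition lsub : {pred V} := W.

Fact lsub_zmod_closed : zmod_closed lsub.
Proof.
split=> [|u v uW vW]; first exact: (rpred0 W).
by apply: (@rpredD _ W) => //; rewrite -scaleN1r; apply: rpredZ.
Qed.

HB.instance Definition _ := GRing.isZmodClosed.Build V lsub lsub_zmod_closed.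

Definition lquot : Type := Quotient.quot lsub.

HB.instance Definition _ := GRing.Zmodule.on lquot.

(** The class of [v] in V/W; [lrep] picks a representative of a class. *)
Definition lclass (v : V) : lquot := (\pi_(Quotient.quot lsub) v)%qT.

Lemma lclass_eq u v : (lclass u == lclass v) = (u - v \in W).
Proof. exact/esym/(Quotient.idealrBE lsub). Qed.

Definition lrep (q : lquot) : V := repr (q : Quotient.quot lsub).

Lemma lclassK : cancel lrep lclass.
Proof. by move=> q; apply: reprK. Qed.

Lemma lclassD u v : lclass (u + v) = lclass u + lclass v.
Proof. exact: (raddfD (\pi_(Quotient.quot lsub))%qT). Qed.

Definition lquot_scale (c : R) (q : lquot) : lquot :=
  lclass (c *: lrep q).

Lemma lquot_scaleE c v : lquot_scale c (lclass v) = lclass (c *: v).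
Proof.
apply/eqP; rewrite lclass_eq -scalerBr rpredZ // -lclass_eq.
by apply/eqP; apply: lclassK.
Qed.

Fact lquot_scaleA a b q : lquot_scale a (lquot_scale b q) = lquot_scale (a * b) q.
Proof. by rewrite -[q]lclassK !lquot_scaleE scalerA. Qed.

Fact lquot_scale1 : left_id 1 lquot_scale.
Proof. by move=> q; rewrite -[q]lclassK lquot_scaleE scale1r. Qed.

Fact lquot_scaleDr : right_distributive lquot_scale +%R.
Proof.
move=> a p q; rewrite -[p]lclassK -[q]lclassK -lclassD !lquot_scaleE.
by rewrite scalerDr lclassD.
Qed.

Fact lquot_scaleDl q : {morph lquot_scale^~ q : a b / a + b}.
Proof.
by move=> a b; rewrite -[q]lclassK !lquot_scaleE scalerDl lclassD.
Qed.

HB.instance Definition _ := GRing.Zmodule_isLmodule.Build R lquot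
  lquot_scaleA lquot_scale1 lquot_scaleDr lquot_scaleDl.

Lemma lclass_linear : linear lclass.
Proof. by move=> c u v; rewrite lclassD -lquot_scaleE. Qed.

End QuotientModule.

Section DirectSum.
Variables (R : pzRingType) (V : nat -> lmodType R).

(** The direct sum of the [V i]: the families with finite support. *)
Record dsum : Type := DSum {
  dsum_fun :> forall i, V i;
  dsum_finite : exists n, forall i, (n <= i)%N -> dsum_fun i = 0
}.

Lemma dsumP (x y : dsum) : (forall i, x i = y i) -> x = y.
Proof.
case: x y => [x hx] [y hy] /= exy.
have {}exy : x = y by apply: functional_extensionality_dep.
by subst y; congr DSum; apply: Prop_irrelevance.
Qed.

HB.instance Definition _ := gen_eqMixin dsum.
HB.instance Definition _ := gen_choiceMixin dsum.

Fact dsum_zero_finite :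
  exists n, forall i, (n <= i)%N -> (fun i => 0 : V i) i = 0.
Proof. by exists 0%N. Qed.
Definition dsum_zero : dsum := DSum dsum_zero_finite.

Fact dsum_opp_finite (x : dsum) :
  exists n, forall i, (n <= i)%N -> (fun i => - x i) i = 0.
Proof. by case: (dsum_finite x) => n hn; exists n => i /hn ->; rewrite oppr0. Qed.
Definition dsum_opp x : dsum := DSum (dsum_opp_finite x).

Fact dsum_add_finite (x y : dsum) :
  exists n, forall i, (n <= i)%N -> (fun i => x i + y i) i = 0.
Proof.
case: (dsum_finite x) (dsum_finite y) => n hn [p hp]; exists (maxn n p) => i.
by rewrite geq_max => /andP[/hn -> /hp ->]; rewrite addr0.
Qed.
Definition dsum_add x y : dsum := DSum (dsum_add_finite x y).

Fact dsum_scale_finite c (x : dsum) :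
  exists n, forall i, (n <= i)%N -> (fun i => c *: x i) i = 0.
Proof. by case: (dsum_finite x) => n hn; exists n => i /hn ->; rewrite scaler0. Qed.
Definition dsum_scale c x : dsum := DSum (dsum_scale_finite c x).

Fact dsum_addA : associative dsum_add.
Proof. by move=> x y z; apply: dsumP => i; apply: addrA. Qed.
Fact dsum_addC : commutative dsum_add.
Proof. by move=> x y; apply: dsumP => i; apply: addrC. Qed.
Fact dsum_add0 : left_id dsum_zero dsum_add.
Proof. by move=> x; apply: dsumP => i; apply: add0r. Qed.
Fact dsum_addN : left_inverse dsum_zero dsum_opp dsum_add.
Proof. by move=> x; apply: dsumP => i; apply: addNr. Qed.

HB.instance Definition _ :=
  GRing.isZmodule.Build dsum dsum_addA dsum_addC dsum_add0 dsum_addN.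

Fact dsum_scaleA a b x : dsum_scale a (dsum_scale b x) = dsum_scale (a * b) x.
Proof. by apply: dsumP => i; apply: scalerA. Qed.
Fact dsum_scale1 : left_id 1 dsum_scale.
Proof. by move=> x; apply: dsumP => i; apply: scale1r. Qed.
Fact dsum_scaleDr : right_distributive dsum_scale +%R.
Proof. by move=> a x y; apply: dsumP => i; apply: scalerDr. Qed.
Fact dsum_scaleDl x : {morph dsum_scale^~ x : a b / a + b}.
Proof. by move=> a b; apply: dsumP => i; apply: scalerDl. Qed.

HB.instance Definition _ := GRing.Zmodule_isLmodule.Build R dsum
  dsum_scaleA dsum_scale1 dsum_scaleDr dsum_scaleDl.

Fact dsum_inj_finite i (v : V i) :
  exists n, forall j, (n <= j)%N -> dfwith (fun k => 0 : V k) v j = 0.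
Proof.
exists i.+1 => j lt_ij; rewrite dfwith_out //.
by apply: contraTneq lt_ij => ->; rewrite ltnn.
Qed.

(** The inclusion of the summand [V i]. *)
Definition dsum_inj i (v : V i) : dsum := DSum (dsum_inj_finite v).

(** [mul] makes the direct sum of the [V i] a graded associative algebra
    (not necessarily unital). *)
Definition graded_assoc_alg (mul : dsum -> dsum -> dsum) : Prop :=
  [/\ forall y, linear (mul^~ y),
      forall x, linear (mul x),
      associative mul &
      forall i j (u : V i) (v : V j),
        exists w : V (i + j)%N,
          mul (dsum_inj u) (dsum_inj v) = dsum_inj w].

End DirectSum.

(** * The Hochschild complex *)

Section Hochschild.
Variables (C : fieldType) (A : confAlgType C).

Local Notation D := (@cder C A).
Local Notation "''L_' i" := (svar C i)
  (at level 8, i at level 2, format "''L_' i").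
Local Notation const a := (vmonom mone a) (only parsing).

Definition der_image : {pred A} := [pred v | `[< exists w, v = D w >]].

Fact der_image_submod : submod_closed der_image.
Proof.
split=> [|c u v /asboolP[u' ->] /asboolP[v' ->]]; apply/asboolP.
  by exists 0; rewrite linear0.
by exists (c *: u' + v'); rewrite linearP.
Qed.

HB.instance Definition _ :=
  GRing.isSubmodClosed.Build C A der_image der_image_submod.

(** Cochains without the sesquilinearity conditions: A/∂A in degree 0, and
    arbitrary maps from A^n to A[λ_0, ..., λ_(n-2)] in degree n >= 1. *)
Definition precochain (n : nat) : lmodType C :=
  match n with
  | 0 => lquot der_image
  | k.+1 => ({ffun 'I_k.+1 -> A} -> vpoly A k)%type
  end.

Definition ffupd (n : nat) (a : {ffun 'I_n -> A}) (i : 'I_n) (x : A) :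
    {ffun 'I_n -> A} :=
  [ffun j => if j == i then x else a j].

Definition inl_ord (n : nat) (i : 'I_n) : 'I_n.+1 := widen_ord (leqnSn n) i.

Definition sesquilinear_map (k : nat) (phi : {ffun 'I_k.+1 -> A} -> vpoly A k) :
    Prop :=
  [/\ forall a i, linear (fun x => phi (ffupd a i x)),
      forall a (i : 'I_k),
        phi (ffupd a (inl_ord i) (D (a (inl_ord i)))) = vmul (- 'L_i) (phi a) &
      forall a,
        phi (ffupd a ord_max (D (a ord_max))) =
          vmap D (phi a) + vmul (\sum_(i < k) 'L_i) (phi a)].

(** The space C^n(A, A). For n = 1 the conditions say that phi is a
    C[∂]-linear map from A to A[] = A. *)
Definition cochain (n : nat) : {pred precochain n} :=
  match n with
  | 0 => predT
  | k.+1 => [pred phi | `[< @sesquilinear_map k phi >]]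
  end.

Definition merge_arg (k : nat) (i : 'I_k.+1) (a : {ffun 'I_k.+2 -> A}) (c : A) :
    {ffun 'I_k.+1 -> A} :=
  [ffun j : 'I_k.+1 => if (j < i)%N then a (inl_ord j)
                       else if j == i then c else a (lift ord0 j)].

Definition merge_var (k : nat) (i : 'I_k.+1) (j : 'I_k) : spoly C k.+1 :=
  if (j < i)%N then 'L_(inl_ord j)
  else if j == i :> nat then 'L_(inl_ord j) + 'L_(lift ord0 j)
  else 'L_(lift ord0 j).

(** In degree n = k.+1 the arguments a_1, ..., a_(n+1) and the variables
    λ_1, ..., λ_n are numbered from 0. *)
Definition hdiff (n : nat) : precochain n -> precochain n.+1 :=
  match n with
  | 0 => fun (q : precochain 0) (a : {ffun 'I_1 -> A}) =>
      const (lprodND D (@cprod C A) (a ord0) (lrep q)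
             - lprod0 (@cprod C A) (lrep q) (a ord0))
  | k.+1 => fun (phi : precochain k.+1) (a : {ffun 'I_k.+2 -> A}) =>
      lprod_ext (@cprod C A) 'L_ord0 (const (a ord0))
        (vsubst (fun j : 'I_k => 'L_(lift ord0 j))
           (phi [ffun j : 'I_k.+1 => a (lift ord0 j)]))
      + \sum_(i < k.+1) (-1) ^+ i.+1 *:
          vpext (fun m c => vmul ('L_i ^+ m ord0)
                   (vsubst (merge_var i) (phi (merge_arg i a c))))
            (cprod (a (inl_ord i)) (a (lift ord0 i)))
      + (-1) ^+ k.+2 *:
          lprod_ext (@cprod C A) (\sum_(j < k.+1) 'L_j)
            (vsubst (fun j : 'I_k => 'L_(inl_ord j))
               (phi [ffun j : 'I_k.+1 => a (inl_ord j)]))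
            (const (a ord_max))
  end.

Lemma vpextU (k : nat) (V W : lmodType C) (F : 'X_{1..k} -> V -> W) m v :
  (forall m, linear (F m)) -> vpext F (vmonom m v) = F m v.
Proof.
move=> F_linear; have sm : (msupp (vmonom m v) `<=` [fset m])%fset.
  by rewrite [vmonom]unlock; apply: msuppU_le.
by rewrite (vpextEw F_linear sm) big_seq_fset1 vmonomE eqxx.
Qed.

Lemma vmul_svar (k : nat) (V : lmodType C) (i : 'I_k) (P : vpoly V k) :
  vmul (svar C i) P = vshift (ucm i) P.
Proof.
rewrite /vmul [svar]unlock msuppU oner_eq0 big_seq_fset1.
by rewrite mcoeffUU scale1r.
Qed.

Lemma vmulN (k : nat) (V : lmodType C) p (P : vpoly V k) :
  vmul (- p) P = - vmul p P.
Proof.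
rewrite /vmul msuppN raddf_sum; apply: eq_bigr => m _.
by rewrite mcoeffN scaleNr.
Qed.

Lemma vshiftU (k : nat) (V : lmodType C) (q m : 'X_{1..k}) (v : V) :
  vshift q (vmonom m v) = vmonom (mmul q m) v.
Proof. by rewrite /vshift vpextU // => m'; apply: vmonom_linear. Qed.

Lemma vpoly_ind (k : nat) (V : lmodType C) (P : vpoly V k -> Prop) :
  P 0 -> (forall p q, P p -> P q -> P (p + q)) ->
  (forall v m, P (vmonom m v)) -> forall p, P p.
Proof. by move=> P0 PD PU p; rewrite (vpolyE p); elim/big_ind: _. Qed.

Lemma lprodND_der a b : lprodND D (@cprod C A) a (D b) = 0.
Proof.
rewrite /lprodND cprod_derr vmul_svar; set F := fun _ _ => _.
have F_linear m : linear (F m).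
  move=> d x y; rewrite /F; elim: (m ord0) => //= n ->.
  by rewrite linearP opprD scalerN.
have vF : linear (vpext F : vpoly A 1 -> A) by apply: vpext_linear.
have mD_linear : linear (vmap D : vpoly A 1 -> vpoly A 1).
  by apply: vpext_linear => m d x y; rewrite linearP vmonom_linear.
have mL_linear := @vshift_linear C A 1 (ucm ord0).
elim/vpoly_ind: (cprod a b) => [|p q|c m].
- by rewrite (linear_fun0 mD_linear) (linear_fun0 mL_linear) addr0 (linear_fun0 vF).
- move=> IHp IHq.
  rewrite (linear_funD mD_linear) (linear_funD mL_linear) addrACA.
  by rewrite (linear_funD vF) IHp IHq addr0.
rewrite (linear_funD vF) vshiftU /vmap !vpextU //; last first.
  by move=> m' d x y; rewrite linearP vmonom_linear.
rewrite {2}/F cmM cmUU add1n iterSr -/(F m (- D c)).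
by rewrite -(linear_funD (F_linear m)) addrN (linear_fun0 (F_linear m)).
Qed.

Lemma lprod0_der a b : lprod0 (@cprod C A) (D a) b = 0.
Proof.
rewrite /lprod0 cprod_derl vmulN vmul_svar.
have mL_linear := @vshift_linear C A 1 (ucm ord0).
elim/vpoly_ind: (cprod a b) => [|p q|c m].
- by rewrite (linear_fun0 mL_linear) oppr0 mcoeff0.
- move=> IHp IHq.
  by rewrite (linear_funD mL_linear) opprD mcoeffD IHp IHq addr0.
rewrite vshiftU mcoeffN vmonomE; case: eqP => [e|_]; last by rewrite oppr0.
by have := congr1 (fun m' : 'X_{1..1} => m' ord0) e; rewrite cmM cmUU cm1.
Qed.

(** The value of the degree 0 differential does not depend on the choice of the
    representative. *)
Lemma hdiff0E (v : A) :
  @hdiff 0 (lclass der_image v) =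
  ((fun a : {ffun 'I_1 -> A} =>
     const (lprodND D (@cprod C A) (a ord0) v - lprod0 (@cprod C A) v (a ord0)))
  : precochain 1).
Proof.
set q := lclass der_image v.
have : v - lrep q \in der_image by rewrite -lclass_eq lclassK.
move=> /asboolP[u /eqP]; rewrite subr_eq addrC => /eqP vE.
apply/funext => a; rewrite [in RHS]vE /=.
have lN := lprodND_linearr (@cprod_linearr C A) D (a ord0).
have l0 := lprod0_linearl (@cprod_linearl C A) (a ord0).
by rewrite (linear_funD lN) (linear_funD l0) lprodND_der lprod0_der !addr0.
Qed.

Lemma hdiff_linear n : linear (@hdiff n).
Proof.
case: n => [|k] c f g.
  rewrite -[f]lclassK -[g]lclassK -lclass_linear !hdiff0E.
  apply/funext => a; rewrite -[RHS]vmonom_linear; congr vmonom.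
  rewrite lprodND_linearr; last exact: cprod_linearr.
  rewrite lprod0_linearl; last exact: cprod_linearl.
  by rewrite scalerBr opprD addrACA.
have lr l P := @lprod_ext_linearr C A _ (@cprod_linearr C A) k.+1 l P.
have ll l Q := @lprod_ext_linearl C A _ (@cprod_linearl C A) k.+1 l Q.
have addE x : (c *: f + g) x = c *: f x + g x by [].
apply/funext => a.
transitivity (c *: @hdiff k.+1 f a + @hdiff k.+1 g a); last by [].
rewrite /hdiff !addE !vsubst_linear lr ll !scalerDr.
rewrite [RHS]addrACA [in RHS](addrACA (c *: lprod_ext _ _ _ _)); congr (_ + _).
  congr (_ + _); rewrite scaler_sumr -big_split /=; apply: eq_bigr => i _.
  rewrite !scalerA mulrC -scalerA -scalerDr; congr (_ *: _).
  apply: vpextP => m x.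
  by rewrite addE vsubst_linear vmul_linear.
by rewrite !scalerA mulrC.
Qed.

Definition cocycle (n : nat) : {pred precochain n} :=
  [pred phi | (phi \in @cochain n) && (hdiff phi == 0)].

Fact cochain_submod n : submod_closed (@cochain n).
Proof.
case: n => [|k]; first by [].
split=> [|c f g /asboolP[f1 f2 f3] /asboolP[g1 g2 g3]]; apply/asboolP.
  split=> [a i|a i|a].
  - by move=> c u v; rewrite scaler0 addr0.
  - by rewrite (linear_fun0 (@vmul_linear _ _ _ _)).
  - rewrite (linear_fun0 (@vmul_linear _ _ _ _)).
    by rewrite (linear_fun0 (@vmap_linear _ _ _ _)) addr0.
have addE x : (c *: f + g) x = c *: f x + g x by [].
split=> [a i d u v|a i|a]; rewrite !addE.
- rewrite f1 g1 !scalerDr !scalerA -!addrA; congr (_ + _); first by rewrite mulrC.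
  by rewrite addrCA.
- by rewrite f2 g2 vmul_linear.
rewrite f3 g3 vmul_linear vmap_linear scalerDr; exact: addrACA.
Qed.

HB.instance Definition _ n :=
  GRing.isSubmodClosed.Build C (precochain n) (@cochain n) (cochain_submod n).

Fact cocycle_submod n : submod_closed (@cocycle n).
Proof.
split=> [|c f g /andP[fC /eqP f0] /andP[gC /eqP g0]]; apply/andP; split.
- exact: rpred0.
- by rewrite (linear_fun0 (@hdiff_linear n)).
- by rewrite rpredD ?rpredZ.
by rewrite hdiff_linear f0 g0 scaler0 addr0.
Qed.
HB.instance Definition _ n :=
  GRing.isSubmodClosed.Build C (precochain n) (@cocycle n) (cocycle_submod n).

Record hker (n : nat) : Type := HKer {
  hker_val :> precochain n;
  hker_cocycle : hker_val \in @cocycle n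
}.

HB.instance Definition _ n := [isSub for @hker_val n].
HB.instance Definition _ n := [Choice of hker n by <:].
HB.instance Definition _ n := [SubChoice_isSubLmodule of hker n by <:].

(** The elements of im d_(n-1) in ker d_n; in degree 0 the zero subspace, so that
    HH^0(A) is ker d_0. *)
Definition coboundary (n : nat) : {pred hker n} :=
  match n with
  | 0 => [pred z | z == 0]
  | k.+1 => [pred z : hker k.+1 |
      `[< exists2 psi, psi \in @cochain k & hdiff psi = z >]]
  end.

Fact coboundary_submod n : submod_closed (@coboundary n).
Proof.
case: n => [|k]; split=> [|c u v].
- by rewrite inE.
- by rewrite !inE => /eqP-> /eqP->; rewrite scaler0 addr0.
- apply/asboolP; exists 0; first exact: rpred0.
  by rewrite (linear_fun0 (@hdiff_linear k)).
move=> /asboolP[f fC fE] /asboolP[g gC gE]; apply/asboolP.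
by exists (c *: f + g); rewrite ?rpredD ?rpredZ // hdiff_linear fE gE.
Qed.
HB.instance Definition _ n :=
  GRing.isSubmodClosed.Build C (hker n) (@coboundary n) (coboundary_submod n).

Definition HH (n : nat) : lmodType C := lquot (@coboundary n).

Definition HHclass (n : nat) (z : hker n) : HH n := lclass (@coboundary n) z.

(** In degrees m = k.+1 and n = l.+1, the variables λ_1, ..., λ_(m-1) of [f] and
    λ_(m+1), ..., λ_(m+n-1) of [g] are taken among λ_1, ..., λ_(m+n-1), numbered
    from 0; note that m + n - 1 is k + l.+1. A class in A/∂A acts through its
    representative [lrep]. *)
Definition cup (m n : nat) : precochain m -> precochain n -> precochain (m + n) :=
  match m, n with
  | 0, 0 => fun (b b' : precochain 0) =>
      lclass der_image (lprod0 (@cprod C A) (lrep b) (lrep b'))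
  | 0, l.+1 => fun (b : precochain 0) (g : precochain l.+1) =>
      fun a : {ffun 'I_l.+1 -> A} =>
        vmap (lprod0 (@cprod C A) (lrep b)) (g a)
  | k.+1, 0 => fun (f : precochain k.+1) (b : precochain 0) =>
      fun a : {ffun 'I_(k.+1 + 0) -> A} =>
        vsubst (fun i : 'I_k => 'L_(lshift 0 i))
          (vmap (fun x => lprodND D (@cprod C A) x (lrep b))
             (f [ffun i : 'I_k.+1 => a (lshift 0 i)]))
  | k.+1, l.+1 => fun (f : precochain k.+1) (g : precochain l.+1) =>
      fun a : {ffun 'I_(k.+1 + l.+1) -> A} =>
        lprod_ext (@cprod C A)
          (\sum_(i < k + l.+1 | (i <= k)%N) 'L_i)
          (vsubst (fun i : 'I_k => 'L_(lshift l.+1 i))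
             (f [ffun i : 'I_k.+1 => a (lshift l.+1 i)]))
          (vsubst (fun j : 'I_l => 'L_(rshift k (lift ord0 j)))
             (g [ffun j : 'I_l.+1 => a (rshift k.+1 j)]))
  end.

End Hochschild.

(* Main.v *)
(** Since C is infinite, a polynomial in λ_1, ..., λ_k with coefficients in A is
    determined by its values at the points of C^k. At points, the product
    a_(t) b of a conformal algebra is a family of bilinear products, indexed by
    t in C, with (a_(s) b)_(s + t) c = a_(s) (b_(t) c); substituting -∂ for a
    formal parameter in this identity gives
      (a_(s) b)_(-∂) c = a_(s) (b_(-∂) c),
      (a_(-∂) b)_(s) c = a_(s) (b_(0) c),
      (a_(-∂) b)_(-∂) c = a_(-∂) (b_(0) c).
    These four identities say that the cup product is associative on cochains
    and satisfies the Leibniz rule d(f ⊔ g) = df ⊔ g + (-1)^m f ⊔ dg, those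
    with -∂ being needed only when a factor has degree 0. Hence cocycles are closed
    under the cup product and coboundaries are an ideal in them. *)

From HB Require Import structures.
Require Import Defs.
From mathcomp Require Import all_boot all_order all_algebra.
From mathcomp Require Import finmap boolp functions.
From mathcomp.multinomials Require Import monalg.
Import GRing.Theory.
Local Open Scope ring_scope.
Set Implicit Arguments.
Unset Strict Implicit.
Unset Printing Implicit Defensive.

(** * Evaluation of polynomials at points *)

Lemma vpoly_linear_ext (C : fieldType) (V W : lmodType C) (k : nat)
    (f g : vpoly V k -> W) :
  linear f -> linear g -> (forall m v, f (vmonom m v) = g (vmonom m v)) ->
  f =1 g.
Proof.
move=> lf lg fg P; elim/vpoly_ind: P => [|P Q IHP IHQ|v m]; last exact: fg.
- by rewrite (linear_fun0 lf) (linear_fun0 lg).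
- by rewrite (linear_funD lf) (linear_funD lg) IHP IHQ.
Qed.

Section MonomialEvaluation.
Context {C : fieldType}.

Definition mon_eval (k : nat) (x : 'I_k -> C) (m : 'X_{1..k}) : C :=
  \prod_(i < k) x i ^+ m i.

Fact mon_eval_mmorphism (k : nat) (x : 'I_k -> C) : mmorphism (mon_eval x).
Proof.
split=> [m m'|]; rewrite /mon_eval.
  by rewrite -big_split /=; apply: eq_bigr => i _; rewrite cmM exprD.
by rewrite big1 // => i _; rewrite cm1.
Qed.

HB.instance Definition _ (k : nat) (x : 'I_k -> C) :=
  isMultiplicative.Build _ _ (mon_eval x) (mon_eval_mmorphism x).

Lemma mon_evalM (k : nat) (x : 'I_k -> C) m m' :
  mon_eval x (mmul m m') = mon_eval x m * mon_eval x m'.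
Proof. exact: mmorphM. Qed.

Lemma mon_eval1 (k : nat) (x : 'I_k -> C) : mon_eval x mone = 1.
Proof. exact: mmorph1. Qed.

Lemma mon_eval_scale (k : nat) (s x : 'I_k -> C) m :
  mon_eval (fun i => s i * x i) m = mon_eval s m * mon_eval x m.
Proof. by rewrite -big_split; apply: eq_bigr => i _; rewrite exprMn. Qed.

Lemma mon_eval_ones (k : nat) (m : 'X_{1..k}) :
  mon_eval (fun=> 1 : C) m = 1.
Proof. by rewrite /mon_eval big1 // => i _; rewrite expr1n. Qed.

Definition spoly_eval (k : nat) (x : 'I_k -> C) : spoly C k -> C :=
  mmap idfun (mon_eval x).

HB.instance Definition _ (k : nat) (x : 'I_k -> C) :=
  GRing.RMorphism.copy (spoly_eval x) (mmap idfun (mon_eval x)).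

Lemma spoly_eval_svar (k : nat) (x : 'I_k -> C) i :
  spoly_eval x (svar C i) = x i.
Proof.
rewrite [svar]unlock /spoly_eval mmapU mul1r /mon_eval (bigD1 i) //= cmUU.
by rewrite big1 ?mulr1 // => j; rewrite cmU eq_sym => /negPf ->.
Qed.

Lemma spoly_evalC (k : nat) (x : 'I_k -> C) c : spoly_eval x c%:MP = c.
Proof. exact: mmapC. Qed.

End MonomialEvaluation.

HB.lock Definition veval (C : fieldType) (V : lmodType C) (k : nat)
    (x : 'I_k -> C) (P : vpoly V k) : V :=
  vpext (fun m v => mon_eval x m *: v) P.
Canonical veval_unlockable := Unlockable veval.unlock.

Section Evaluation.
Context {C : fieldType} {V : lmodType C}.


Lemma veval_linear (k : nat) (x : 'I_k -> C) : linear (@veval C V k x).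
Proof.
rewrite unlock; apply: vpext_linear => m c u v.
by rewrite scalerDr !scalerA mulrC.
Qed.

HB.instance Definition _ (k : nat) (x : 'I_k -> C) :=
  GRing.isLinear.Build C (vpoly V k) V *:%R (@veval C V k x) (veval_linear x).

Lemma veval_vmonom (k : nat) (x : 'I_k -> C) m (v : V) :
  veval x (vmonom m v) = mon_eval x m *: v.
Proof.
rewrite [veval]unlock vpextU // => m' c u w.
by rewrite scalerDr !scalerA mulrC.
Qed.

Lemma veval_const (k : nat) (x : 'I_k -> C) (v : V) :
  veval x (vmonom mone v) = v.
Proof. by rewrite veval_vmonom mon_eval1 scale1r. Qed.

Lemma veval_vtens (k : nat) (x : 'I_k -> C) p (v : V) :
  veval x (vtens p v) = spoly_eval x p *: v.
Proof.
rewrite /vtens raddf_sum /= /spoly_eval mmapE scaler_suml.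
by apply: eq_bigr => m _; rewrite veval_vmonom scalerA mulrC.
Qed.

Lemma veval_vshift (k : nat) (x : 'I_k -> C) q (P : vpoly V k) :
  veval x (vshift q P) = mon_eval x q *: veval x P.
Proof.
pose f (P : vpoly V k) := veval x (vshift q P).
pose g (P : vpoly V k) := mon_eval x q *: veval x P.
apply: (@vpoly_linear_ext _ _ _ _ f g) => [c u v|c u v|m v]; rewrite /f /g.
- by rewrite vshift_linear linearP.
- by rewrite linearP scalerDr !scalerA mulrC.
- by rewrite vshiftU !veval_vmonom mon_evalM scalerA.
Qed.

Lemma veval_vmul (k : nat) (x : 'I_k -> C) p (P : vpoly V k) :
  veval x (vmul p P) = spoly_eval x p *: veval x P.
Proof.
rewrite /vmul raddf_sum /= /spoly_eval mmapE scaler_suml.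
by apply: eq_bigr => m _; rewrite linearZ /= veval_vshift scalerA.
Qed.

Lemma veval_vsubst (k l : nat) (x : 'I_l -> C) s (P : vpoly V k) :
  veval x (vsubst s P) = veval (fun i => spoly_eval x (s i)) P.
Proof.
pose f (P : vpoly V k) := veval x (vsubst s P).
apply: (@vpoly_linear_ext _ _ _ _ f) => [c u v|c u v|m v]; rewrite /f.
- by rewrite vsubst_linear linearP.
- exact: linearP.
rewrite /vsubst vpextU; last by move=> m'; apply: vtens_linear.
rewrite veval_vtens veval_vmonom rmorph_prod; congr (_ *: _).
by apply: eq_bigr => i _; rewrite rmorphXn.
Qed.

Lemma veval_vmap (k : nat) (x : 'I_k -> C) (f : V -> V) (P : vpoly V k) :
  linear f -> veval x (vmap f P) = f (veval x P).
Proof.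
move=> lf; have lm m : linear (fun v => vmonom m (f v) : vpoly V k).
  by move=> c u v; rewrite lf vmonom_linear.
pose g (P : vpoly V k) := veval x (vmap f P).
pose h (P : vpoly V k) := f (veval x P).
apply: (@vpoly_linear_ext _ _ _ _ g h) => [c u v|c u v|m v]; rewrite /g /h.
- by rewrite /vmap (vpext_linear lm) linearP.
- by rewrite linearP lf.
rewrite /vmap vpextU // !veval_vmonom -[_ *: v]addr0 lf.
by rewrite (linear_fun0 lf) addr0.
Qed.

(* The difference of P(s x) and s^m P(x) has no coefficient at [m], which
   reduces the number of coefficients of a polynomial that vanishes at every
   point. *)
Lemma veval_eq0 (k : nat) (P : vpoly V k) :
  [pchar C] =i pred0 -> (forall x, veval x P = 0) -> P = 0.
Proof.
move=> charC P0; apply/malgP => m; rewrite mcoeff0.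
(* An arbitrary finite set of monomials and an arbitrary family of coefficients allow induction on
   the number of monomials. *)
suff vanish n (D : {fset 'X_{1..k}}) (v : 'X_{1..k} -> V) : #|` D| = n ->
    (forall x, \sum_(m <- D) mon_eval x m *: v m = 0) ->
    forall m, m \in D -> v m = 0.
  have [mP|/mcoeff_outdom //] := boolP (m \in msupp P).
  apply: (vanish _ (msupp P) (fun m => P@_m) erefl) => // x.
  by have := P0 x; rewrite !unlock.
elim: n D v {P P0 m} => [|n IH] D v Dn v0 p pD.
  by move/eqP: Dn pD; rewrite cardfs_eq0 => /eqP ->.
have [m mD] : exists m, m \in D by exists p.
have other m' : m' \in (D `\ m)%fset -> v m' = 0.
  move=> m'D; have : m' != m by move: m'D; rewrite in_fsetD1 => /andP[].
  move=> /cmP ne; have [i ni] : exists i, m' i != m i.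
    apply/existsP; apply: contraT; rewrite negb_exists => /forallP h.
    by case: ne => i; apply/eqP/negPn.
  (* Scaling coordinate [i] by 2 multiplies the value of [q] by 2^(q i); powers of 2 are distinct in
     characteristic zero, so [m] and [m'] are separated. *)
  pose s (j : 'I_k) : C := if j == i then 2%:R else 1.
  have sE q : mon_eval s q = 2%:R ^+ q i.
    rewrite /mon_eval (bigD1 i) //= /s eqxx big1 ?mulr1 // => j /negPf ->.
    by rewrite expr1n.
  have sm : mon_eval s m' - mon_eval s m != 0.
    have inj2 a b : (2%:R ^+ a == 2%:R ^+ b :> C) -> (a <= b)%N -> a = b.
      move=> /eqP e ab; have : (2 ^ b - 2 ^ a)%:R == 0 :> C.
        by rewrite natrB ?leq_exp2l // !natrX e subrr.
      rewrite ((GRing.pcharf0P C).1 charC) subn_eq0 leq_exp2l // => ba.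
      by apply/eqP; rewrite eqn_leq ab.
    rewrite subr_eq0 !sE; apply: contra ni => e.
    by case/orP: (leq_total (m' i) (m i)) => /inj2 -> //; rewrite eq_sym.
  have /eqP : (mon_eval s m' - mon_eval s m) *: v m' = 0.
    pose w q := (mon_eval s q - mon_eval s m) *: v q.
    apply: (IH (D `\ m)%fset w) => //.
      by move: Dn; rewrite (cardfsD1 m D) mD add1n => -[].
    move=> x; have := v0 (fun j => s j * x j); have := v0 x.
    rewrite !(big_fsetD1 m mD) /= => /eqP.
    rewrite addrC addr_eq0 => /eqP vx vsx.
    transitivity (
        \sum_(q <- (D `\ m)%fset) mon_eval (fun j => s j * x j) q *: v q
        - mon_eval s m *: (\sum_(q <- (D `\ m)%fset) mon_eval x q *: v q)).
      rewrite scaler_sumr -sumrB; apply: eq_bigr => q _.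
      rewrite mon_eval_scale !scalerA -scalerBl mulrBr mulrC.
      by rewrite (mulrC (mon_eval x q)).
    apply/eqP; rewrite vx scalerN opprK scalerA -mon_eval_scale addrC.
    exact/eqP.
  by rewrite scaler_eq0 (negPf sm) => /eqP.
(* Once all other coefficients vanish, the value at (1, ..., 1) is the coefficient of [m]. *)
have [->|ne] := eqVneq p m; last by apply: other; rewrite in_fsetD1 ne.
have := v0 (fun=> 1); rewrite (big_fsetD1 m mD) /= big_seq big1 ?addr0.
  by rewrite mon_eval_ones scale1r.
by move=> m' /other ->; rewrite scaler0.
Qed.

Lemma veval_inj (k : nat) (P Q : vpoly V k) :
  [pchar C] =i pred0 -> (forall x, veval x P = veval x Q) -> P = Q.
Proof.
move=> charC PQ; apply/eqP; rewrite -subr_eq0; apply/eqP/veval_eq0 => // x.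
by rewrite raddfB /= PQ subrr.
Qed.

End Evaluation.

(** * The products at scalars and at -∂ *)

Section PointProducts.
Context {C : fieldType} {A : confAlgType C}.
Implicit Types (a b c : A) (t x y : C).

Definition cmul t a b : A := veval (fun=> t) (cprod a b).

Definition cmulND a b : A := lprodND (cder A) (@cprod C A) a b.

Lemma cmul_linearl t b : linear ((cmul t)^~ b).
Proof. by move=> d u v; rewrite /cmul cprod_linearl linearP. Qed.

Lemma cmul_linearr t a : linear (cmul t a).
Proof. by move=> d u v; rewrite /cmul cprod_linearr linearP. Qed.

HB.instance Definition _ t a :=
  GRing.isLinear.Build C A A *:%R (cmul t a) (cmul_linearr t a).

Lemma cmulDl t b : {morph (cmul t)^~ b : u v / u + v}.
Proof. exact: linear_funD (cmul_linearl t b). Qed.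

Lemma cmulZl t b d u : cmul t (d *: u) b = d *: cmul t u b.
Proof.
have := cmul_linearl t b d u 0.
by rewrite /= addr0 (linear_fun0 (cmul_linearl t b)) addr0.
Qed.

Lemma cmulNl t b u : cmul t (- u) b = - cmul t u b.
Proof. exact: (linear_funN (cmul_linearl t b)). Qed.

Lemma cmul_suml t b (I : Type) (r : seq I) (P : pred I) (F : I -> A) :
  cmul t (\sum_(i <- r | P i) F i) b = \sum_(i <- r | P i) cmul t (F i) b.
Proof.
exact: (big_morph _ (cmulDl t b) (linear_fun0 (cmul_linearl t b))).
Qed.

Lemma cmulDr t a : {morph cmul t a : u v / u + v}.
Proof. exact: raddfD. Qed.

Lemma cmulNr t a u : cmul t a (- u) = - cmul t a u.
Proof. exact: raddfN. Qed.

Lemma cmulZr t a d u : cmul t a (d *: u) = d *: cmul t a u.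
Proof. exact: linearZ. Qed.

Lemma cmul_sumr t a (I : Type) (r : seq I) (P : pred I) (F : I -> A) :
  cmul t a (\sum_(i <- r | P i) F i) = \sum_(i <- r | P i) cmul t a (F i).
Proof. exact: raddf_sum. Qed.

Lemma cmul_derl t a b : cmul t (cder A a) b = - t *: cmul t a b.
Proof.
by rewrite /cmul cprod_derl veval_vmul rmorphN /= spoly_eval_svar.
Qed.

Lemma cmul_derr t a b :
  cmul t a (cder A b) = cder A (cmul t a b) + t *: cmul t a b.
Proof.
rewrite /cmul cprod_derr raddfD /= veval_vmul spoly_eval_svar veval_vmap //.
exact: linearP.
Qed.

Lemma veval_lprod_at (k : nat) (x : 'I_k -> C) l a b :
  veval x (lprod_at (@cprod C A) l a b) = cmul (spoly_eval x l) a b.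
Proof. by rewrite /lprod_at veval_vsubst. Qed.

Lemma veval_lprod_ext (k : nat) (x : 'I_k -> C) l (P Q : vpoly A k) :
  veval x (lprod_ext (@cprod C A) l P Q) =
  cmul (spoly_eval x l) (veval x P) (veval x Q).
Proof.
have ll := lprod_ext_linearl (@cprod_linearl C A).
have lr := lprod_ext_linearr (@cprod_linearr C A).
pose f (P : vpoly A k) := veval x (lprod_ext (@cprod C A) l P Q).
pose g (P : vpoly A k) := cmul (spoly_eval x l) (veval x P) (veval x Q).
apply: (@vpoly_linear_ext _ _ _ _ f g) => [d u v|d u v|m a]; rewrite /f /g.
- by rewrite ll linearP.
- by rewrite linearP cmulDl cmulZl.
pose f' Q := veval x (lprod_ext (@cprod C A) l (vmonom m a) Q).
pose g' (Q : vpoly A k) :=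
  cmul (spoly_eval x l) (veval x (vmonom m a)) (veval x Q).
apply: (@vpoly_linear_ext _ _ _ _ f' g') => [d u v|d u v|m' b]; rewrite /f' /g'.
- by rewrite lr linearP.
- by rewrite !linearP.
have lshift m1 : linear (fun b =>
    vshift (mmul m m1) (lprod_at (@cprod C A) l a b)).
  by move=> d u v; rewrite /lprod_at cprod_linearr vsubst_linear vshift_linear.
rewrite /lprod_ext !vpextU //; last first.
  move=> m1 d u v; apply: vpextP => m2 w.
  by rewrite /lprod_at cprod_linearl vsubst_linear vshift_linear.
rewrite veval_vshift veval_lprod_at mon_evalM !veval_vmonom cmulZl linearZ /=.
by rewrite scalerA.
Qed.

Lemma cmulA x y a b c : cmul (x + y) (cmul x a b) c = cmul x a (cmul y b c).
Proof.
pose z (i : 'I_2) := if i == ord0 then x else y.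
have := congr1 (veval z) (cprodA a b c).
rewrite !veval_lprod_ext !veval_lprod_at !veval_const.
by rewrite rmorphD /= !spoly_eval_svar.
Qed.

(** At 0 only the monomial 1 survives, so a_(0) b is a member of the family [cmul t] and falls under
    [cmulA]. *)
Lemma lprod0E a b : lprod0 (@cprod C A) a b = cmul 0 a b.
Proof.
pose f (P : vpoly A 1) := P@_mone.
apply: (@vpoly_linear_ext _ _ _ _ f (veval (fun=> 0))) => [d u v|d u v|m v].
- by rewrite /f mcoeffD vcoeffZ.
- exact: linearP.
rewrite /f vmonomE veval_vmonom /mon_eval big_ord1 expr0n scaler_nat.
congr (_ *+ nat_of_bool _); apply/eqP/eqP => [->|m0]; first by rewrite cm1.
by apply/eqP/cmP => i; rewrite ord1 m0 cm1.
Qed.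

(** The substitution λ := -∂. *)
Definition eval_negder (P : vpoly A 1) : A :=
  vpext (fun m c => iter (m ord0) (fun u => - cder A u) c) P.

Fact iter_negder_linear n : linear (iter n (fun u => - cder A u)).
Proof.
by elim: n => // n IH d u v; rewrite !iterS IH linearP opprD scalerN.
Qed.

Lemma eval_negder_linear : linear eval_negder.
Proof. by apply: vpext_linear => m; apply: iter_negder_linear. Qed.

HB.instance Definition _ :=
  GRing.isLinear.Build C (vpoly A 1) A *:%R eval_negder eval_negder_linear.

Lemma eval_negder_vmonom m (v : A) :
  eval_negder (vmonom m v) = iter (m ord0) (fun u => - cder A u) v.
Proof.
by rewrite /eval_negder vpextU // => m'; apply: iter_negder_linear.
Qed.

Lemma eval_negder_vshift m P :
  eval_negder (vshift m P) =
  iter (m ord0) (fun u => - cder A u) (eval_negder P).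
Proof.
pose f P := eval_negder (vshift m P).
pose g P := iter (m ord0) (fun u => - cder A u) (eval_negder P).
apply: (@vpoly_linear_ext _ _ _ _ f g) => [d u v|d u v|m' v]; rewrite /f /g.
- by rewrite vshift_linear linearP.
- by rewrite linearP iter_negder_linear.
by rewrite vshiftU !eval_negder_vmonom cmM iterD.
Qed.

Lemma cmulNDE a b : cmulND a b = eval_negder (cprod a b).
Proof. by []. Qed.

Lemma cmulND_linearl b : linear (cmulND^~ b).
Proof. by move=> d u v; rewrite !cmulNDE cprod_linearl linearP. Qed.

Lemma cmulND_linearr a : linear (cmulND a).
Proof. by move=> d u v; rewrite !cmulNDE cprod_linearr linearP. Qed.

HB.instance Definition _ a :=
  GRing.isLinear.Build C A A *:%R (cmulND a) (cmulND_linearr a).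

Lemma cmulNDDl b : {morph cmulND^~ b : u v / u + v}.
Proof. exact: linear_funD (cmulND_linearl b). Qed.

Lemma cmulNDNl b u : cmulND (- u) b = - cmulND u b.
Proof. exact: (linear_funN (cmulND_linearl b)). Qed.

Lemma cmulNDZl b d u : cmulND (d *: u) b = d *: cmulND u b.
Proof.
have := cmulND_linearl b d u 0.
by rewrite /= addr0 (linear_fun0 (cmulND_linearl b)) addr0.
Qed.

Lemma cmulND_suml b (I : Type) (r : seq I) (P : pred I) (F : I -> A) :
  cmulND (\sum_(i <- r | P i) F i) b = \sum_(i <- r | P i) cmulND (F i) b.
Proof.
exact: (big_morph _ (cmulNDDl b) (linear_fun0 (cmulND_linearl b))).
Qed.

(** By sesquilinearity ∂ on the left is multiplication by -λ, which the substitution λ := -∂ turns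
    into ∂. *)
Lemma cmulND_derl a b : cmulND (cder A a) b = cder A (cmulND a b).
Proof.
rewrite !cmulNDE cprod_derl vmulN vmul_svar raddfN /= eval_negder_vshift.
by rewrite cmUU /= opprK.
Qed.

(** In the left argument of the product at x, -∂ acts as the scalar x. So a_(-∂) b may be replaced
    there by a_(x) b, and [cmulA] applies with y = 0. *)
Lemma cmul_cmulND x a b c : cmul x (cmulND a b) c = cmul x a (cmul 0 b c).
Proof.
rewrite -cmulA addr0; set P := cprod a b.
transitivity (cmul x (veval (fun=> x) P) c); last by [].
pose f P := cmul x (eval_negder P) c.
pose g (P : vpoly A 1) := cmul x (veval (fun=> x) P) c.
apply: (@vpoly_linear_ext _ _ _ _ f g) => [d u v|d u v|m v]; rewrite /f /g.
- by rewrite linearP cmulDl cmulZl.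
- by rewrite linearP cmulDl cmulZl.
rewrite eval_negder_vmonom veval_vmonom /mon_eval big_ord1 cmulZl.
elim: (m ord0) => [|n IH] /=; first by rewrite scale1r.
by rewrite cmulNl cmul_derl scaleNr opprK IH scalerA exprS.
Qed.

(* Polynomially in ν, [(a_(x) b)_(ν) c = a_(x) (b_(ν - x) c)]; then ν := -∂. *)
Lemma cmulND_cmul x a b c : [pchar C] =i pred0 ->
  cmulND (cmul x a b) c = cmul x a (cmulND b c).
Proof.
(* [s] is ν - x, and [T] sends P(ν) to a_(x) P(ν - x). *)
move=> charC; pose s : spoly C 1 := svar C ord0 - x%:MP.
pose T (P : vpoly A 1) : vpoly A 1 := vmap (cmul x a) (vsubst (fun=> s) P).
have sE (y : _ -> C) : spoly_eval y s = y ord0 - x.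
  by rewrite rmorphB /= spoly_eval_svar spoly_evalC.
have vT P (y : _ -> C) : veval y (T P) = cmul x a (veval (fun=> y ord0 - x) P).
  rewrite veval_vmap; last exact: cmul_linearr.
  by rewrite veval_vsubst sE.
have lT : linear T.
  by move=> d u v; rewrite /T vsubst_linear (vmap_linear (cmul x a)).
have -> : cmulND (cmul x a b) c = eval_negder (T (cprod b c)).
  rewrite cmulNDE; congr eval_negder; apply: veval_inj => // y; rewrite vT.
  rewrite -[RHS](cmulA x (y ord0 - x)) addrC subrK /cmul; congr (veval _ _).
  by apply/funext => i; rewrite ord1.
rewrite cmulNDE.
apply: (@vpoly_linear_ext _ _ _ _ (eval_negder \o T) (cmul x a \o eval_negder))
  => [d u v|d u v|m v] /=.
- by rewrite lT linearP.
- by rewrite !linearP.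
have -> : T (vmonom m v) = vmul (s ^+ m ord0) (vmonom mone (cmul x a v)).
  apply: veval_inj => // y; rewrite vT veval_vmonom veval_vmul veval_const.
  by rewrite linearZ /= /mon_eval big_ord1 rmorphXn /= sE.
rewrite eval_negder_vmonom.
elim: (m ord0) => [|n IH] /=.
  transitivity (eval_negder (vmonom mone (cmul x a v))); last first.
    by rewrite eval_negder_vmonom cm1.
  congr eval_negder; apply: veval_inj => // y.
  by rewrite veval_vmul rmorph1 scale1r.
(* One more factor ν - x becomes -∂ - x under ν := -∂, which matches a_(x) (-∂u) = (-∂ - x) (a_(x)
   u). *)
have -> : vmul (s ^+ n.+1) (vmonom mone (cmul x a v)) =
    vshift (ucm ord0) (vmul (s ^+ n) (vmonom mone (cmul x a v)))
    - x *: vmul (s ^+ n) (vmonom mone (cmul x a v)).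
  apply: veval_inj => // y; rewrite exprS -vmul_svar raddfB /= linearZ /=.
  by rewrite !veval_vmul rmorphM /= sE spoly_eval_svar -scalerA scalerBl.
rewrite raddfB /= linearZ /= eval_negder_vshift cmUU /= IH.
by rewrite raddfN /= cmul_derr opprD.
Qed.

(* Polynomially in ν, [(a_(ν) b)_(ν) c = a_(ν) (b_(0) c)]; then ν := -∂. *)
Lemma cmulNDA a b c : [pchar C] =i pred0 ->
  cmulND (cmulND a b) c = cmulND a (cmul 0 b c).
Proof.
move=> charC.
(* [T] sends P(ν) to P(ν)_(ν) c, with the same variable ν in the subscript. *)
pose T (P : vpoly A 1) : vpoly A 1 := vpext (fun m u => vshift m (cprod u c)) P.
have lm m : linear (fun u => vshift m (cprod u c)).
  by move=> d u v; rewrite cprod_linearl vshift_linear.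
have lT : linear T by apply: vpext_linear.
have TU m v : T (vmonom m v) = vshift m (cprod v c) by rewrite /T vpextU.
have vT P (y : _ -> C) : veval y (T P) = cmul (y ord0) (veval y P) c.
  pose f P := veval y (T P).
  pose g (P : vpoly A 1) := cmul (y ord0) (veval y P) c.
  have yE : y = fun=> y ord0 by apply/funext => i; rewrite ord1.
  apply: (@vpoly_linear_ext _ _ _ _ f g) => [d u v|d u v|m v]; rewrite /f /g.
  - by rewrite lT linearP.
  - by rewrite linearP cmulDl cmulZl.
  by rewrite TU veval_vshift veval_vmonom cmulZl {2}yE.
have -> : cmulND a (cmul 0 b c) = eval_negder (T (cprod a b)).
  rewrite cmulNDE; congr eval_negder; apply: veval_inj => // y; rewrite vT.
  have -> : y = fun=> y ord0 by apply/funext => i; rewrite ord1.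
  by rewrite -[LHS](cmulA _ 0) addr0.
rewrite [cmulND a b]cmulNDE.
apply: (@vpoly_linear_ext _ _ _ _ (cmulND^~ c \o eval_negder)
  (eval_negder \o T)) => [d u v|d u v|m v] /=.
- by rewrite linearP cmulND_linearl.
- by rewrite lT linearP.
rewrite TU eval_negder_vshift eval_negder_vmonom -cmulNDE.
elim: (m ord0) => //= n <-.
by rewrite (linear_funN (cmulND_linearl c)) cmulND_derl.
Qed.

End PointProducts.

(** * Shifting, merging and updating sequences *)

Section SequenceOperations.
Context {T : Type}.
Implicit Types (s : nat -> T) (c : T) (i n : nat).

Definition shiftn n s : nat -> T := fun j => s (n + j)%N.

(** Entries i and i + 1 give way to the single entry [c]: their product for arguments, their sum for
    scalars. *)
Definition mergen i c s : nat -> T :=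
  fun j => if (j < i)%N then s j else if j == i then c else s j.+1.

Definition updn i c s : nat -> T := fun j => if j == i then c else s j.

Lemma shiftn0 s : shiftn 0 s = s.
Proof. by []. Qed.

Lemma shiftnD m n s : shiftn m (shiftn n s) = shiftn (n + m) s.
Proof. by apply/funext => j; rewrite /shiftn addnA. Qed.

(** After a merge inside the first factor of a cup product, the arguments of the second factor start
    one place later in the original sequence. *)
Lemma shiftn_mergen_ge m i c s :
  (i < m)%N -> shiftn m (mergen i c s) = shiftn m.+1 s.
Proof.
move=> im; apply/funext => j; rewrite /shiftn /mergen.
have imj : (i < m + j)%N by rewrite ltn_addr.
by rewrite ltnNge (ltnW imj) gtn_eqF.
Qed.

Lemma shiftn_mergen m i c s :
  shiftn m (mergen (m + i) c s) = mergen i c (shiftn m s).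
Proof.
by apply/funext => j; rewrite /shiftn /mergen ltn_add2l eqn_add2l addnS.
Qed.

Lemma mergen_lt i c s j : (j < i)%N -> mergen i c s j = s j.
Proof. by rewrite /mergen => ->. Qed.

Lemma shiftn_updn_ge m i c s :
  (i < m)%N -> shiftn m (updn i c s) = shiftn m s.
Proof.
move=> im; apply/funext => j.
by rewrite /shiftn /updn gtn_eqF // ltn_addr.
Qed.

Lemma shiftn_updn m i c s :
  shiftn m (updn (m + i) c s) = updn i c (shiftn m s).
Proof. by apply/funext => j; rewrite /shiftn /updn eqn_add2l. Qed.

Lemma updn_neq i c s j : j != i -> updn i c s j = s j.
Proof. by rewrite /updn => /negPf ->. Qed.

End SequenceOperations.

(** The total of the scalars is the outer subscript of a cup product; merging two of them into their
    sum preserves it. *)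
Lemma sum_mergen (V : zmodType) n i (x : nat -> V) : (i < n)%N ->
  \sum_(j < n) mergen i (x i + x i.+1) x j = \sum_(j < n.+1) x j.
Proof.
elim: n => // n IH; rewrite ltnS leq_eqVlt => /predU1P[->|lt_in].
  rewrite !big_ord_recr /= /mergen ltnn eqxx addrA; congr (_ + _ + _).
  by apply: eq_bigr => j _; rewrite ltn_ord.
rewrite big_ord_recr [RHS]big_ord_recr /= IH // /mergen.
by rewrite ltnNge (ltnW lt_in) gtn_eqF.
Qed.

(** * The Leibniz rule for functions of sequences *)

(* A cochain of degree n, evaluated at points of C^(n-1), is a function of
   sequences of arguments and of scalars of which it only reads the first
   entries. This puts the cochains of all degrees in the same type. *)
Section SequenceCochains.
Context {C : fieldType} {A : confAlgType C}.
Implicit Types (a : nat -> A) (x : nat -> C).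
Implicit Types (F G : (nat -> A) -> (nat -> C) -> A).

(** There is one scalar fewer than arguments: the last argument carries no λ. *)
Definition local_fun n F : Prop := forall a a' x x',
  (forall j, (j < n)%N -> a j = a' j) ->
  (forall j, (j.+1 < n)%N -> x j = x' j) -> F a x = F a' x'.

(** This models d_n for n >= 1; at n = 0 the first subscript would be x_0 in place of -∂, whence
    [seq_diff0]. In the last merge, i = n - 1, the merged scalar lies just beyond those that a local
    [F] reads, as the special subscript of that term requires. *)
Definition seq_diff n F a x : A :=
  cmul (x 0%N) (a 0%N) (F (shiftn 1 a) (shiftn 1 x))
  + \sum_(i < n) (-1) ^+ i.+1 *:
      F (mergen i (cmul (x i) (a i) (a i.+1)) a) (mergen i (x i + x i.+1) x)
  + (-1) ^+ n.+1 *: cmul (\sum_(j < n) x j) (F a x) (a n).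

Definition seq_diff0 (v : A) a : A := cmulND (a 0%N) v - cmul 0 v (a 0%N).

(** For m = 0 the subscript is the empty sum 0, so b_(0) g is included. A right factor of degree 0
    is handled by [cmulND] instead. *)
Definition seq_cup m F G a x : A :=
  cmul (\sum_(j < m) x j) (F a x) (G (shiftn m a) (shiftn m x)).

(** Merges at positions below m belong to dF, those from m on to dG. The last term of dF and the
    first term of dG have no counterpart on the left and cancel. *)
Lemma seq_diff_cup m n F G a x : local_fun m F -> (0 < m)%N ->
  seq_diff (m + n) (seq_cup m F G) a x =
  seq_cup m.+1 (seq_diff m F) G a x
  + (-1) ^+ m *: seq_cup m F (seq_diff n G) a x.
Proof.
move=> Floc m_gt0; rewrite /seq_diff /seq_cup.
rewrite !shiftnD !add1n !cmulDl cmulZl cmul_suml.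
rewrite !cmulDr cmulZr cmul_sumr !scalerDr scaler_sumr.
rewrite addn1 /(shiftn m x 0) /(shiftn m a 0) !addn0.
have first_term : cmul (x 0%N) (a 0%N)
      (cmul (\sum_(j < m) shiftn 1 x j) (F (shiftn 1 a) (shiftn 1 x))
         (G (shiftn m.+1 a) (shiftn m.+1 x))) =
    cmul (\sum_(j < m.+1) x j) (cmul (x 0%N) (a 0%N) (F (shiftn 1 a) (shiftn 1 x)))
      (G (shiftn m.+1 a) (shiftn m.+1 x)).
  by rewrite -cmulA big_ord_recl.
(* These are the two terms that cancel; they come with opposite signs (-1)^(m+1) and (-1)^m. *)
have middle_term : cmul (\sum_(j < m.+1) x j)
      (cmul (\sum_(j < m) x j) (F a x) (a m)) (G (shiftn m.+1 a) (shiftn m.+1 x)) =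
    cmul (\sum_(j < m) x j) (F a x)
      (cmul (x m) (a m) (G (shiftn m.+1 a) (shiftn m.+1 x))).
  by rewrite -cmulA big_ord_recr.
have last_term : cmul (\sum_(j < m + n) x j)
      (cmul (\sum_(j < m) x j) (F a x) (G (shiftn m a) (shiftn m x))) (a (m + n)%N) =
    cmul (\sum_(j < m) x j) (F a x)
      (cmul (\sum_(j < n) shiftn m x j) (G (shiftn m a) (shiftn m x))
         (shiftn m a n)).
  by rewrite -cmulA big_split_ord.
rewrite first_term middle_term last_term big_split_ord /=.
rewrite scalerA -exprD addnS [(-1) ^+ m.+1]exprS mulN1r scaleNr.
set t1 := cmul _ _ _; set t2 := _ *: cmul _ _ (cmul (x m) _ _).
set t3 := (-1) ^+ (m + n).+1 *: _.
(* This includes i = m - 1, where the argument [a m] is absorbed into the first factor. *)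
have -> : \sum_(i < m) (-1) ^+ i.+1 *:
     cmul (\sum_(j < m) mergen i (x i + x i.+1) x j)
       (F (mergen i (cmul (x i) (a i) (a i.+1)) a) (mergen i (x i + x i.+1) x))
       (G (shiftn m (mergen i (cmul (x i) (a i) (a i.+1)) a))
          (shiftn m (mergen i (x i + x i.+1) x))) =
   \sum_(i < m) cmul (\sum_(j < m.+1) x j) ((-1) ^+ i.+1 *:
      F (mergen i (cmul (x i) (a i) (a i.+1)) a) (mergen i (x i + x i.+1) x))
      (G (shiftn m.+1 a) (shiftn m.+1 x)).
  apply: eq_bigr => i _.
  by rewrite cmulZl sum_mergen ?ltn_ord // !shiftn_mergen_ge ?ltn_ord.
set s1 := \sum_(i < m) _.
(* A merge at m + i lies beyond every entry that [F] and the outer subscript read, so it only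
   reaches [G]. *)
have -> : \sum_(i < n) (-1) ^+ (m + i).+1 *:
     cmul (\sum_(j < m) mergen (m + i) (x (m + i)%N + x (m + i).+1) x j)
       (F (mergen (m + i) (cmul (x (m + i)%N) (a (m + i)%N) (a (m + i).+1)) a)
          (mergen (m + i) (x (m + i)%N + x (m + i).+1) x))
       (G (shiftn m (mergen (m + i) (cmul (x (m + i)%N) (a (m + i)%N) (a (m + i).+1)) a))
          (shiftn m (mergen (m + i) (x (m + i)%N + x (m + i).+1) x))) =
   \sum_(i < n) (-1) ^+ m *: cmul (\sum_(j < m) x j) (F a x) ((-1) ^+ i.+1 *:
      G (mergen i (cmul (shiftn m x i) (shiftn m a i) (shiftn m a i.+1)) (shiftn m a))
        (mergen i (shiftn m x i + shiftn m x i.+1) (shiftn m x))).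
  apply: eq_bigr => i _.
  rewrite cmulZr scalerA -exprD addnS !shiftn_mergen /shiftn !addnS.
  congr (_ *: cmul _ _ _).
    by apply: eq_bigr => j _; rewrite mergen_lt // ltn_addr.
  apply: Floc => j jm; rewrite mergen_lt // ltn_addr //; exact: ltnW.
set s2 := \sum_(i < n) _.
rewrite -!addrA; congr (_ + (_ + _)).
by rewrite addKr.
Qed.

(** The part a_(-∂) v of dv yields a_(x) (v_(0) G), the first term on the left; the part v_(0) a
    cancels the first term of v_(0) dG. *)
Lemma seq_diff_cup0l n v G a x :
  seq_diff n (seq_cup 0 (fun _ _ => v) G) a x =
  seq_cup 1 (fun a _ => seq_diff0 v a) G a x
  + seq_cup 0 (fun _ _ => v) (seq_diff n G) a x.
Proof.
rewrite /seq_diff /seq_cup /seq_diff0 !big_ord0 big_ord1 !shiftnD.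
rewrite cmulDl cmulNl cmul_cmulND !cmulDr cmul_sumr cmulZr.
rewrite -!addrA -[cmul 0 v (cmul (x 0%N) _ _)]cmulA add0r addKr.
congr (_ + (_ + _)).
  apply: eq_bigr => i _; rewrite !big_ord0 cmulZr.
  by congr (_ *: cmul _ _ (G _ _)); apply/funext.
by rewrite -cmulA add0r.
Qed.

(** The last term of dF, followed by the product with [v] at -∂, cancels the part a_(-∂) v of dv;
    the part v_(0) a gives the last term on the left. *)
Lemma seq_diff_cup0r m F v a x : [pchar C] =i pred0 ->
  seq_diff m (fun a x => cmulND (F a x) v) a x =
  cmulND (seq_diff m F a x) v
  + (-1) ^+ m *: seq_cup m F (fun a _ => seq_diff0 v a) a x.
Proof.
move=> charC; rewrite /seq_diff /seq_cup /seq_diff0 /shiftn addn0.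
rewrite !cmulNDDl cmulND_suml cmulNDZl -!cmulND_cmul // cmulDr cmulNr.
rewrite -cmulND_cmul // scalerDr scalerN cmul_cmulND.
rewrite -!addrA; congr (_ + (_ + _)).
  by apply: eq_bigr => i _; rewrite cmulNDZl.
by rewrite exprS mulN1r !scaleNr addKr.
Qed.

(** The terms (v_(0) a)_(-∂) w and v_(0) (a_(-∂) w) cancel. *)
Lemma seq_diff0_cmul v w a : [pchar C] =i pred0 ->
  seq_diff0 (cmul 0 v w) a =
  cmulND (seq_diff0 v a) w + cmul 0 v (seq_diff0 w a).
Proof.
move=> charC; rewrite /seq_diff0 cmulNDDl cmulNDNl cmulDr cmulNr.
by rewrite cmulNDA // cmulND_cmul // addrA subrK -cmulA addr0.
Qed.

End SequenceCochains.

(** * From cochains to functions of sequences and back *)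

Section CochainEvaluation.
Context {C : fieldType} {A : confAlgType C}.
Hypothesis charC : [pchar C] =i pred0.
Implicit Types (a : nat -> A) (x : nat -> C).

(** In degree 0 the value is the chosen representative, which is not linear in the class; linearity
    and the formula for the differential are therefore stated for n > 0. *)
Definition cochain_eval n : precochain A n -> (nat -> A) -> (nat -> C) -> A :=
  match n with
  | 0 => fun f _ _ => lrep f
  | k.+1 => fun f a x =>
      veval (fun i : 'I_k => x i) (f [ffun i : 'I_k.+1 => a i])
  end.

Lemma cochain_eval_local n (f : precochain A n) : local_fun n (cochain_eval f).
Proof.
case: n f => [|k] f a a' x x' aE xE //=.
have -> : (fun i : 'I_k => x i) = (fun i : 'I_k => x' i).
  by apply/funext => i; apply: xE; rewrite ltnS.
by congr (veval _ (f _)); apply/ffunP => i; rewrite !ffunE aE.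
Qed.

Lemma ffun_extension k (T : Type) (b : {ffun 'I_k.+1 -> T}) :
  exists a : nat -> T, b = [ffun i : 'I_k.+1 => a i].
Proof.
(* Beyond k, [inord] takes a default value, which is never read. *)
exists (fun j => b (inord j)); apply/ffunP => i.
by rewrite ffunE inord_val.
Qed.

Lemma vpoly_eq_seq k (P Q : vpoly A k) :
  (forall x : nat -> C, veval (fun i : 'I_k => x i) P = veval (fun i => x i) Q) ->
  P = Q.
Proof.
move=> PQ; apply: veval_inj => // x.
have -> : x = fun i : 'I_k => oapp x 0 (insub (val i)).
  by apply/funext => i; rewrite valK.
exact: (PQ (fun j => oapp x 0 (insub j))).
Qed.

Lemma cochain_eval_inj n : injective (@cochain_eval n).
Proof.
case: n => [|k] f g /= fg.
  have /(congr1 (lclass (@der_image C A))) := congr1 (fun F => F (fun=> 0) (fun=> 0)) fg.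
  by rewrite !lclassK.
apply/funext => b; have [a ->] := ffun_extension b.
apply: vpoly_eq_seq => x.
exact: (congr1 (fun F => F a x) fg).
Qed.

Definition sesquilinear_fun k (F : (nat -> A) -> (nat -> C) -> A) : Prop :=
  [/\ forall a x i, (i <= k)%N -> linear (fun u => F (updn i u a) x),
      forall a x i, (i < k)%N -> F (updn i (cder A (a i)) a) x = - x i *: F a x &
      forall a x, F (updn k (cder A (a k)) a) x =
        cder A (F a x) + (\sum_(i < k) x i) *: F a x].

Lemma ffupd_updn k a (i : 'I_k.+1) u :
  ffupd [ffun j : 'I_k.+1 => a j] i u = [ffun j : 'I_k.+1 => updn i u a j].
Proof. by apply/ffunP => j; rewrite !ffunE. Qed.

Lemma cochainP k (f : precochain A k.+1) :
  f \in @cochain C A k.+1 <-> sesquilinear_fun k (cochain_eval f).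
Proof.
split=> [/asboolP[f1 f2 f3]|[f1 f2 f3]].
  split=> [a x i ik c u v|a x i ik|a x] /=.
  - have := f1 [ffun j : 'I_k.+1 => a j] (Ordinal (ik : (i < k.+1)%N)) c u v.
    by rewrite !ffupd_updn => ->; rewrite linearP.
  - have := f2 [ffun j : 'I_k.+1 => a j] (Ordinal ik).
    rewrite ffupd_updn ffunE /= => ->.
    by rewrite veval_vmul rmorphN /= spoly_eval_svar.
  - have := f3 [ffun j : 'I_k.+1 => a j]; rewrite ffupd_updn ffunE /= => ->.
    rewrite raddfD /= veval_vmap; last exact: linearP.
    rewrite veval_vmul rmorph_sum; congr (_ + _ *: _).
    by apply: eq_bigr => i _; rewrite /= spoly_eval_svar.
apply/asboolP; split=> [b i c u v|b i|b]; have [a ->] := ffun_extension b;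
  apply: vpoly_eq_seq => x.
- by rewrite !ffupd_updn linearP; apply: (f1 a x i); rewrite -ltnS.
- rewrite ffupd_updn ffunE veval_vmul rmorphN /= spoly_eval_svar.
  exact: (f2 a x i).
- rewrite ffupd_updn ffunE raddfD /= veval_vmap; last exact: linearP.
  rewrite veval_vmul rmorph_sum; have := f3 a x; rewrite /= => ->.
  by congr (_ + _ *: _); apply: eq_bigr => i _; rewrite /= spoly_eval_svar.
Qed.

Lemma sesquilinear_fun_mergen k F a x i : sesquilinear_fun k F -> (i <= k)%N ->
  linear (fun u => F (mergen i u a) x).
Proof.
move=> [F_linear _ _] ik c u v; have := F_linear (mergen i 0 a) x i ik c u v.
(* Varying the merged entry is an update of one fixed sequence, whose placeholder entry is 0. *)
have upd w : updn i w (mergen i 0 a) = mergen i w a.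
  by apply/funext => j; rewrite /updn /mergen; case: eqP => // ->; rewrite ltnn.
by rewrite !upd.
Qed.

Lemma merge_arg_mergen k a (i : 'I_k.+1) u :
  merge_arg i [ffun j : 'I_k.+2 => a j] u = [ffun j : 'I_k.+1 => mergen i u a j].
Proof. by apply/ffunP => j; rewrite !ffunE /mergen. Qed.

Lemma spoly_eval_merge_var k x (i : 'I_k.+1) (j : 'I_k) :
  spoly_eval (fun j : 'I_k.+1 => x j) (merge_var C i j) =
  mergen i (x i + x i.+1) x j.
Proof.
rewrite /merge_var /mergen; case: ltnP => _; first by rewrite spoly_eval_svar.
by case: eqP => [<-|_]; rewrite ?rmorphD /= !spoly_eval_svar.
Qed.

(** The differential applies [f] to each coefficient of the product and multiplies by powers of λ_i;
    linearity of [f] in the merged argument collects this into the value of [f] at the product at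
    [x i]. *)
Lemma veval_merge_term k (f : precochain A k.+1) a x (i : 'I_k.+1)
    (P : vpoly A 1) :
  f \in @cochain C A k.+1 ->
  veval (fun j : 'I_k.+1 => x j) (vpext (fun m c => vmul (svar C i ^+ m ord0)
    (vsubst (merge_var C i) (f (merge_arg i [ffun j : 'I_k.+2 => a j] c)))) P) =
  cochain_eval f (mergen i (veval (fun=> x i) P) a) (mergen i (x i + x i.+1) x).
Proof.
move=> /cochainP f_sesq.
pose G (m : 'X_{1..1}) c := vmul (svar C i ^+ m ord0)
    (vsubst (merge_var C i) (f (merge_arg i [ffun j : 'I_k.+2 => a j] c))).
have GE (m : 'X_{1..1}) c (y : nat -> C) : veval (fun j : 'I_k.+1 => y j) (G m c) =
    y i ^+ m ord0 *: cochain_eval f (mergen i c a) (mergen i (y i + y i.+1) y).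
  rewrite veval_vmul rmorphXn /= spoly_eval_svar veval_vsubst merge_arg_mergen.
  congr (_ *: veval _ _).
  by apply/funext => j; rewrite spoly_eval_merge_var.
have ik : (i <= k)%N by rewrite -ltnS.
have f_linear y := sesquilinear_fun_mergen a y f_sesq ik.
have lG m : linear (G m).
  move=> d u v; apply: vpoly_eq_seq => y.
  by rewrite linearP /= !GE f_linear scalerDr !scalerA mulrC.
pose g P := veval (fun j : 'I_k.+1 => x j) (vpext G P).
pose h (P : vpoly A 1) :=
  cochain_eval f (mergen i (veval (fun=> x i) P) a) (mergen i (x i + x i.+1) x).
apply: (@vpoly_linear_ext _ _ _ _ g h) => [d u v|d u v|m c]; rewrite /g /h.
- by rewrite (vpext_linear lG) linearP.
- by rewrite linearP f_linear.
rewrite vpextU // GE veval_vmonom /mon_eval big_ord1.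
have := f_linear (mergen i (x i + x i.+1) x) (x i ^+ m ord0) c 0.
by rewrite !addr0 (linear_fun0 (f_linear _)) addr0 => ->.
Qed.

Lemma seq_diff_evalS k (f : precochain A k.+1) : f \in @cochain C A k.+1 ->
  cochain_eval (hdiff f) = seq_diff k.+1 (cochain_eval f).
Proof.
move=> fC; apply/funext => a; apply/funext => x.
rewrite /= /seq_diff !raddfD /= linearZ /= raddf_sum /= !veval_lprod_ext.
rewrite !veval_vsubst !veval_const !ffunE spoly_eval_svar rmorph_sum /=.
congr (cmul _ _ _ + _ + _ *: cmul _ _ _); last first.
- congr veval; first by apply/funext => i; rewrite spoly_eval_svar.
  by congr f; apply/ffunP => i; rewrite !ffunE.
- by apply: eq_bigr => i _; rewrite spoly_eval_svar.
- apply: eq_bigr => i _; rewrite linearZ /=; congr (_ *: _).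
  by rewrite !ffunE; apply: veval_merge_term.
- congr veval; first by apply/funext => i; rewrite spoly_eval_svar.
  by congr f; apply/ffunP => i; rewrite !ffunE.
Qed.

Lemma seq_diff_eval n (f : precochain A n) :
  (0 < n)%N -> f \in @cochain C A n ->
  cochain_eval (hdiff f) = seq_diff n (cochain_eval f).
Proof. by case: n f => // n f _; apply: seq_diff_evalS. Qed.

Lemma seq_diff0_class (v : A) a x :
  cochain_eval (hdiff (lclass (@der_image C A) v : precochain A 0)) a x =
  seq_diff0 v a.
Proof. by rewrite hdiff0E /= veval_const !ffunE /seq_diff0 lprod0E. Qed.

Lemma seq_diff0_eval (b : precochain A 0) :
  cochain_eval (hdiff b) = fun a _ => seq_diff0 (lrep b) a.
Proof.
apply/funext => a; apply/funext => x.
by rewrite -{1}[b]lclassK seq_diff0_class.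
Qed.

Lemma cup_eval m n (f : precochain A m) (g : precochain A n) : (0 < n)%N ->
  cochain_eval (cup f g) = seq_cup m (cochain_eval f) (cochain_eval g).
Proof.
case: n g => // n g _; apply/funext => a; apply/funext => x.
case: m f => [|m] f; rewrite /seq_cup.
  rewrite big_ord0 /= veval_vmap.
    by rewrite lprod0E.
  by move=> d u v; rewrite !lprod0E linearP.
rewrite /= veval_lprod_ext !veval_vsubst rmorph_sum /=; congr cmul.
- rewrite (big_ord_widen (m + n.+1) x); last by rewrite addnS ltnS leq_addr.
  by apply: eq_bigr => i _; rewrite spoly_eval_svar.
- congr veval; first by apply/funext => i; rewrite spoly_eval_svar.
  by congr f; apply/ffunP => i; rewrite !ffunE.
- congr veval.
    by apply/funext => i; rewrite spoly_eval_svar /= /shiftn addSnnS.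
  by congr g; apply/ffunP => i; rewrite !ffunE.
Qed.

Lemma cup0r_eval m (f : precochain A m) (b : precochain A 0) : (0 < m)%N ->
  cochain_eval (cup f b) = fun a x => cmulND (cochain_eval f a x) (lrep b).
Proof.
case: m f => // m f _; apply/funext => a; apply/funext => x /=.
have vsE (P : vpoly A m) : veval (fun i : 'I_(m + 0) => x i)
    (vsubst (fun i : 'I_m => svar C (lshift 0 i)) P) = veval (fun i => x i) P.
  rewrite veval_vsubst; congr veval.
  by apply/funext => i; rewrite spoly_eval_svar.
rewrite vsE veval_vmap; last exact: cmulND_linearl.
congr (cmulND (veval _ (f _)) _).
by apply/ffunP => i; rewrite !ffunE.
Qed.

Lemma lrep_lclass (v : A) :
  exists w, lrep (lclass (@der_image C A) v) = cder A w + v.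
Proof.
have : lrep (lclass (@der_image C A) v) - v \in @der_image C A.
  by rewrite -lclass_eq lclassK.
by move=> /asboolP[w /eqP]; rewrite subr_eq => /eqP ->; exists w.
Qed.

(** Two representatives differ by some ∂w, and (∂w)_(0) c = 0. *)
Lemma cmul0_rep (v c : A) :
  cmul 0 (lrep (lclass (@der_image C A) v)) c = cmul 0 v c.
Proof.
have [w ->] := lrep_lclass v.
by rewrite cmulDl -!lprod0E lprod0_der add0r.
Qed.

(** Here the reason is c_(-∂) (∂w) = 0. *)
Lemma cmulND_rep (c v : A) :
  cmulND c (lrep (lclass (@der_image C A) v)) = cmulND c v.
Proof.
have [w ->] := lrep_lclass v.
by rewrite raddfD /= [X in X + _]lprodND_der add0r.
Qed.

(** Here c_(0) (∂w) = ∂(c_(0) w) vanishes only modulo ∂A, so the class has to be taken. *)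
Lemma lclass_cmul0_rep (c v : A) :
  lclass (@der_image C A) (cmul 0 c (lrep (lclass (@der_image C A) v))) =
  lclass (@der_image C A) (cmul 0 c v).
Proof.
have [w ->] := lrep_lclass v.
apply/eqP; rewrite lclass_eq cmulDr addrK cmul_derr scale0r addr0.
by apply/asboolP; exists (cmul 0 c w).
Qed.

Lemma cup00E (b b' : precochain A 0) :
  cup b b' = lclass (@der_image C A) (cmul 0 (lrep b) (lrep b')).
Proof. by rewrite /= lprod0E. Qed.

Lemma cochain_eval_linear n a x : (0 < n)%N ->
  linear (fun f : precochain A n => cochain_eval f a x).
Proof. by case: n => // n _ d f g /=; rewrite -linearP. Qed.

Lemma cup_linearl m n (g : precochain A n) :
  linear (fun f : precochain A m => cup f g).
Proof.
move=> d f f'; case: (posnP (m + n)) => [|mn_gt0].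
  case: m n f f' g => [|//] [|//] f f' g _.
  (* As [lrep] is not linear, [f] and [f'] are written as classes of their representatives, and
     [cmul0_rep] removes the representative of the combination. *)
  rewrite !cup00E -lclass_linear -{1}[f]lclassK -{1}[f']lclassK.
  by rewrite -lclass_linear cmul0_rep cmulDl cmulZl.
apply: cochain_eval_inj; apply/funext => a; apply/funext => x.
rewrite (cochain_eval_linear a x mn_gt0).
case: (posnP n) g mn_gt0 => [->|n_gt0] g mn_gt0.
  rewrite addn0 in mn_gt0; rewrite !cup0r_eval //.
  by rewrite (cochain_eval_linear a x mn_gt0) cmulNDDl cmulNDZl.
rewrite !cup_eval // /seq_cup.
case: (posnP m) f f' {mn_gt0} => [->|m_gt0] f f'; last first.
  by rewrite (cochain_eval_linear a x m_gt0) cmulDl cmulZl.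
rewrite big_ord0 /= -{1}[f]lclassK -{1}[f']lclassK.
by rewrite -lclass_linear cmul0_rep cmulDl cmulZl.
Qed.

Lemma cup_linearr m n (f : precochain A m) :
  linear (fun g : precochain A n => cup f g).
Proof.
move=> d g g'; case: (posnP (m + n)) => [|mn_gt0].
  case: m n f g g' => [|//] [|//] f g g' _.
  rewrite !cup00E -lclass_linear -{1}[g]lclassK -{1}[g']lclassK.
  by rewrite -lclass_linear lclass_cmul0_rep cmulDr cmulZr.
apply: cochain_eval_inj; apply/funext => a; apply/funext => x.
rewrite (cochain_eval_linear a x mn_gt0).
case: (posnP n) g g' mn_gt0 => [->|n_gt0] g g' mn_gt0.
  rewrite addn0 in mn_gt0; rewrite !cup0r_eval //.
  rewrite -{1}[g]lclassK -{1}[g']lclassK -lclass_linear cmulND_rep.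
  exact: linearP.
rewrite !cup_eval // /seq_cup.
by rewrite (cochain_eval_linear _ _ n_gt0) cmulDr cmulZr.
Qed.

Lemma sesquilinear_cmulND k F v : sesquilinear_fun k F ->
  sesquilinear_fun k (fun a x => cmulND (F a x) v).
Proof.
move=> [F1 F2 F3]; split=> [a x i ik c u w|a x i ik|a x].
- by rewrite F1 // cmulNDDl cmulNDZl.
- by rewrite F2 // cmulNDZl.
- by rewrite F3 cmulNDDl cmulND_derl cmulNDZl.
Qed.

Lemma sesquilinear_cup0l k v G : sesquilinear_fun k G ->
  sesquilinear_fun k (seq_cup 0 (fun _ _ => v) G).
Proof.
move=> [G1 G2 G3].
split=> [a x i ik c u w|a x i ik|a x]; rewrite /seq_cup !big_ord0 !shiftn0.
- by rewrite G1 // cmulDr cmulZr.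
- by rewrite G2 // cmulZr.
- by rewrite G3 cmulDr cmul_derr cmulZr scale0r addr0.
Qed.

Lemma sesquilinear_cup k l F G : local_fun k.+1 F ->
  sesquilinear_fun k F -> sesquilinear_fun l G ->
  sesquilinear_fun (k + l.+1) (seq_cup k.+1 F G).
Proof.
move=> F_local [F1 F2 F3] [G1 G2 G3]; rewrite -addSnnS /seq_cup.
have F_upd a x i c : F (updn (k.+1 + i) c a) x = F a x.
  by apply: F_local => // j jk; rewrite updn_neq // ltn_eqF // ltn_addr.
split=> [a x i ik c u w|a x i ik|a x].
- have [lt_ik|le_ki] := ltnP i k.+1.
    by rewrite !shiftn_updn_ge // F1 // cmulDl cmulZl.
  rewrite -(subnKC le_ki) !F_upd !shiftn_updn G1; last by rewrite leq_subLR.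
  by rewrite cmulDr cmulZr.
- have [lt_ik|le_ki] := ltnP i k.+1.
    rewrite shiftn_updn_ge //; have [lt_ik'|le_ki] := ltnP i k.
      by rewrite F2 // cmulZl.
    (* At the last argument of [F], ∂ produces ∂ + x_0 + ... + x_(k-1); the outer product turns this
       ∂ into -(x_0 + ... + x_k), which leaves -x_k. *)
    have -> : i = k by apply/eqP; rewrite eqn_leq -ltnS lt_ik.
    rewrite F3 cmulDl cmulZl cmul_derl -scalerDl big_ord_recr /=.
    by rewrite opprD addrAC addNr add0r.
  rewrite -(subnKC le_ki) !F_upd !shiftn_updn.
  by rewrite (G2 (shiftn k.+1 a)) ?cmulZr // ltn_subLR.
- rewrite F_upd shiftn_updn G3 cmulDr cmulZr cmul_derr -addrA -scalerDl.
  by rewrite big_split_ord.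
Qed.

Lemma cup_cochain m n (f : precochain A m) (g : precochain A n) :
  f \in @cochain C A m -> g \in @cochain C A n ->
  cup f g \in @cochain C A (m + n).
Proof.
case: n g => [|n] g; case: m f => [|m] f fC gC //.
- apply/(@cochainP (m + 0)); rewrite [cochain_eval _](cup0r_eval f g) // addn0.
  by apply: sesquilinear_cmulND; apply/cochainP.
- apply/(@cochainP n); rewrite [cochain_eval _](cup_eval f g) //.
  by apply: sesquilinear_cup0l; apply/cochainP.
- apply/(@cochainP (m + n.+1)); rewrite [cochain_eval _](cup_eval f g) //.
  apply: sesquilinear_cup; last exact/cochainP; last exact/cochainP.
  exact: cochain_eval_local.
Qed.

(** The rule is stated for evaluations because the degrees (m + n).+1 and m + n.+1 are not
    convertible. The cases follow which factors have degree 0. *)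
Lemma hdiff_cup m n (f : precochain A m) (g : precochain A n) :
  f \in @cochain C A m -> g \in @cochain C A n ->
  cochain_eval (hdiff (cup f g)) = fun a x =>
    cochain_eval (cup (hdiff f) g) a x
    + (-1) ^+ m *: cochain_eval (cup f (hdiff g)) a x.
Proof.
move=> fC gC; have fgC := cup_cochain fC gC.
apply/funext => a; apply/funext => x.
rewrite [in X in _ + X]cup_eval //.
case: (posnP n) g gC fgC => [->|n_gt0] g gC fgC.
  rewrite seq_diff0_eval cup0r_eval //.
  case: (posnP m) f fC fgC => [->|m_gt0] f fC fgC.
    rewrite [cup f g]cup00E seq_diff0_class seq_diff0_cmul // seq_diff0_eval.
    by rewrite expr0 scale1r /seq_cup big_ord0.
  rewrite seq_diff_eval ?addn0 // cup0r_eval // seq_diff_eval //.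
  by rewrite addn0 seq_diff_cup0r.
rewrite [cochain_eval (cup (hdiff f) g)]cup_eval //.
rewrite [cochain_eval (hdiff (cup f g))]seq_diff_eval ?addn_gt0 ?n_gt0 ?orbT //.
rewrite [cochain_eval (cup f g)]cup_eval // [cochain_eval (hdiff g)]seq_diff_eval //.
case: (posnP m) f fC {fgC} => [->|m_gt0] f fC.
  by rewrite seq_diff0_eval expr0 scale1r; apply: seq_diff_cup0l.
rewrite seq_diff_eval //.
apply: seq_diff_cup => //; exact: cochain_eval_local.
Qed.

(** Degrees n, p > 0 use [cmulA]; n = 0 < m, p uses [cmul_cmulND]; p = 0 < n uses [cmulND_cmul]; n =
    p = 0 < m uses [cmulNDA]. For m = n = 0, [cmulA] at 0 remains, up to the choice of
    representatives. *)
Lemma cup_assoc_eval m n p (f : precochain A m) (g : precochain A n)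
    (h : precochain A p) :
  cochain_eval (cup (cup f g) h) = cochain_eval (cup f (cup g h)).
Proof.
apply/funext => a; apply/funext => x.
case: (posnP p) h => [->|p_gt0] h; last first.
  rewrite (@cup_eval (m + n) p) //.
  rewrite (@cup_eval m (n + p)) ?addn_gt0 ?p_gt0 ?orbT //.
  rewrite [cochain_eval (cup g h)]cup_eval // /seq_cup shiftnD.
  case: (posnP n) g => [->|n_gt0] g; last first.
    by rewrite cup_eval // /seq_cup -cmulA shiftnD big_split_ord.
  rewrite [in RHS]big_ord0; case: (posnP m) f => [->|m_gt0] f; last first.
    by rewrite cup0r_eval // addn0 cmul_cmulND.
  by rewrite !big_ord0 [cup f g]cup00E cmul0_rep -cmulA addr0.
case: (posnP n) g => [->|n_gt0] g; last first.
  rewrite cup0r_eval ?addn_gt0 ?n_gt0 ?orbT // cup_eval // /seq_cup.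
  rewrite cmulND_cmul // [cochain_eval (cup f (cup _ _))]cup_eval; last first.
    by rewrite addn_gt0 n_gt0.
  by rewrite /seq_cup cup0r_eval.
rewrite [cup g h]cup00E; case: (posnP m) f => [->|m_gt0] f; last first.
  by rewrite !cup0r_eval ?addn0 // cmulND_rep cmulNDA.
by rewrite [cup f g]cup00E /= !lprod0E cmul0_rep lclass_cmul0_rep -cmulA addr0.
Qed.

End CochainEvaluation.

(** * The product on cohomology *)

Section HochschildCohomology.
Context {C : fieldType} {A : confAlgType C}.
Hypothesis charC : [pchar C] =i pred0.

Lemma cochain_eval0 n a x : (0 < n)%N ->
  cochain_eval (0 : precochain A n) a x = 0.
Proof. by move=> n_gt0; apply: (linear_fun0 (cochain_eval_linear a x n_gt0)). Qed.

Lemma cup0l m n (g : precochain A n) : cup (0 : precochain A m) g = 0.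
Proof. exact: (linear_fun0 (cup_linearl charC g)). Qed.

Lemma cup0r m n (f : precochain A m) : cup f (0 : precochain A n) = 0.
Proof. exact: (linear_fun0 (cup_linearr charC f)). Qed.

Lemma cup_cocycle m n (f : precochain A m) (g : precochain A n) :
  f \in @cocycle C A m -> g \in @cocycle C A n ->
  cup f g \in @cocycle C A (m + n).
Proof.
move=> /andP[fC /eqP df0] /andP[gC /eqP dg0].
apply/andP; split; first exact: cup_cochain.
apply/eqP/(cochain_eval_inj charC); apply/funext => a; apply/funext => x.
rewrite hdiff_cup // df0 dg0 cup0l cup0r !cochain_eval0 ?addnS //.
by rewrite scaler0 addr0.
Qed.

Definition hker_cup m n (z : hker A m) (w : hker A n) : hker A (m + n) :=
  HKer (cup_cocycle (hker_cocycle z) (hker_cocycle w)).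

Lemma hker_cup_linearl m n (w : hker A n) :
  linear (fun z : hker A m => hker_cup z w).
Proof. by move=> d z z'; apply: val_inj; apply: cup_linearl. Qed.

Lemma hker_cup_linearr m n (z : hker A m) :
  linear (fun w : hker A n => hker_cup z w).
Proof. by move=> d w w'; apply: val_inj; apply: cup_linearr. Qed.

(** The degree enters through an equation, so that m + k.+1 can be treated as a successor. *)
Lemma eval_coboundary n k (z : hker A n) (psi : precochain A k) :
  n = k.+1 -> psi \in @cochain C A k ->
  cochain_eval (hdiff psi) = cochain_eval z -> z \in @coboundary C A n.
Proof.
move=> nk psiC; subst n => /(cochain_eval_inj charC) psiz.
by apply/asboolP; exists psi.
Qed.

(** If z = dψ and dw = 0, then z ⊔ w = d(ψ ⊔ w). *)
Lemma coboundary_cupl m n (z : hker A m) (w : hker A n) :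
  z \in @coboundary C A m -> hker_cup z w \in @coboundary C A (m + n).
Proof.
case: m z => [|k] z.
  by move=> /eqP ->; rewrite (linear_fun0 (hker_cup_linearl w)) rpred0.
move=> /asboolP[psi psiC psiz]; case/andP: (hker_cocycle w) => wC /eqP dw0.
apply: (@eval_coboundary _ _ _ (cup psi w)); rewrite ?cup_cochain //.
apply/funext => a; apply/funext => x.
by rewrite hdiff_cup // dw0 cup0r cochain_eval0 ?addnS // scaler0 addr0 psiz.
Qed.

Lemma coboundary_cupr m n (z : hker A m) (w : hker A n) :
  w \in @coboundary C A n -> hker_cup z w \in @coboundary C A (m + n).
Proof.
case: n w => [|k] w.
  by move=> /eqP ->; rewrite (linear_fun0 (hker_cup_linearr z)) rpred0.
move=> /asboolP[psi psiC psiw]; case/andP: (hker_cocycle z) => zC /eqP dz0.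
(* The sign compensates the (-1)^m of the Leibniz rule. *)
apply: (@eval_coboundary _ _ _ ((-1) ^+ m *: cup z psi)); first by rewrite addnS.
  by rewrite rpredZ // cup_cochain.
apply/funext => a; apply/funext => x.
have := @hdiff_linear C A (m + k) ((-1) ^+ m) (cup z psi) 0.
rewrite (linear_fun0 (@hdiff_linear C A _)) !addr0 => ->.
have := cochain_eval_linear a x (ltn0Sn (m + k)) ((-1) ^+ m) (hdiff (cup z psi)) 0.
rewrite cochain_eval0 // !addr0 => ->.
rewrite hdiff_cup // dz0 cup0l cochain_eval0 ?addSn // add0r psiw.
by rewrite scalerA -expr2 sqrr_sign scale1r.
Qed.

Definition HHcup m n (p : HH A m) (q : HH A n) : HH A (m + n) :=
  HHclass (hker_cup (lrep p) (lrep q)).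

(** This is well-definedness: z' ⊔ w' - z ⊔ w = (z' - z) ⊔ w' + z ⊔ (w' - w), and both terms are
    coboundaries. *)
Lemma HHcup_class m n (z : hker A m) (w : hker A n) :
  HHcup (HHclass z) (HHclass w) = HHclass (hker_cup z w).
Proof.
have rep k (u : hker A k) : lrep (HHclass u) - u \in @coboundary C A k.
  by rewrite -lclass_eq lclassK.
apply/eqP; rewrite lclass_eq.
set z' := lrep _; set w' := lrep _.
have -> : hker_cup z' w' - hker_cup z w = hker_cup (z' - z) w' + hker_cup z (w' - w).
  rewrite (linear_funD (hker_cup_linearl w')) (linear_funN (hker_cup_linearl w')).
  rewrite (linear_funD (hker_cup_linearr z)) (linear_funN (hker_cup_linearr z)).
  by rewrite addrA subrK.
by apply: rpredD; [apply: coboundary_cupl | apply: coboundary_cupr]; apply: rep.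
Qed.

Lemma HHclass_linear n : linear (@HHclass C A n).
Proof. exact: lclass_linear. Qed.

Lemma HHclass_surj m (p : HH A m) : exists z, p = HHclass z.
Proof. by exists (lrep p); rewrite /HHclass lclassK. Qed.

Lemma HHcup_linearl m n (q : HH A n) : linear (fun p : HH A m => HHcup p q).
Proof.
move=> d p p'; have [z ->] := HHclass_surj p; have [z' ->] := HHclass_surj p'.
have [w ->] := HHclass_surj q.
by rewrite -HHclass_linear !HHcup_class hker_cup_linearl HHclass_linear.
Qed.

Lemma HHcup_linearr m n (p : HH A m) : linear (fun q : HH A n => HHcup p q).
Proof.
move=> d q q'; have [w ->] := HHclass_surj q; have [w' ->] := HHclass_surj q'.
have [z ->] := HHclass_surj p.
by rewrite -HHclass_linear !HHcup_class hker_cup_linearr HHclass_linear.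
Qed.

(** Classes in degrees that are equal but not convertible are compared inside the direct sum,
    without transport; associativity takes this form. *)
Lemma HHclass_eval_eq m n (z : hker A m) (w : hker A n) :
  m = n -> cochain_eval z = cochain_eval w ->
  dsum_inj (HHclass z) = dsum_inj (HHclass w) :> dsum (HH A).
Proof.
move=> mn; subst n => /(cochain_eval_inj charC) zw.
by congr (dsum_inj (HHclass _)); apply: val_inj.
Qed.

Lemma HHcupA m n k (p : HH A m) (q : HH A n) (r : HH A k) :
  dsum_inj (HHcup (HHcup p q) r) = dsum_inj (HHcup p (HHcup q r)) :> dsum (HH A).
Proof.
have [z ->] := HHclass_surj p; have [w ->] := HHclass_surj q.
have [u ->] := HHclass_surj r; rewrite !HHcup_class.
apply: HHclass_eval_eq; first by rewrite addnA.
exact: cup_assoc_eval.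
Qed.

End HochschildCohomology.

(** * Extending a graded product to the direct sum *)

Section GradedProduct.
Context {R : pzRingType} {V : nat -> lmodType R}.
Variable mu : forall i j, V i -> V j -> V (i + j)%N.
Hypothesis mu_linearl : forall i j (v : V j), linear (fun u : V i => mu u v).
Hypothesis mu_linearr : forall i j (u : V i), linear (fun v : V j => mu u v).
Hypothesis muA : forall i j k (u : V i) (v : V j) (w : V k),
  dsum_inj (mu (mu u v) w) = dsum_inj (mu u (mu v w)) :> dsum V.

Lemma dsum_inj_linear i : linear (fun v : V i => dsum_inj v : dsum V).
Proof.
move=> c u v; apply: dsumP => j /=.
have [<-|ij] := eqVneq i j; first by rewrite !dfwith_in.
by rewrite !dfwith_out // scaler0 addr0.
Qed.

Lemma dsum_inj0 i : dsum_inj (0 : V i) = 0 :> dsum V.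
Proof. exact: (linear_fun0 (@dsum_inj_linear i)). Qed.

Lemma dsum_sumE (I : Type) (r : seq I) (P : pred I) (F : I -> dsum V) n :
  (\sum_(i <- r | P i) F i) n = \sum_(i <- r | P i) F i n.
Proof. exact: (big_morph (fun x : dsum V => x n)). Qed.

Lemma dsumE (x : dsum V) : exists n, x = \sum_(i < n) dsum_inj (x i).
Proof.
have [n xn] := dsum_finite x; exists n; apply: dsumP => j.
rewrite dsum_sumE; have [jn|nj] := ltnP j n.
  rewrite (bigD1 (Ordinal jn)) //= dfwith_in big1 ?addr0 // => i ij.
  by rewrite dfwith_out.
rewrite xn // big1 // => i _; rewrite /= dfwith_out //.
by rewrite ltn_eqF // (leq_trans _ nj).
Qed.

Lemma dsum_ind (P : dsum V -> Prop) :
  P 0 -> (forall x y, P x -> P y -> P (x + y)) ->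
  (forall i (v : V i), P (dsum_inj v)) -> forall x, P x.
Proof.
move=> P0 PD PI x; have [n ->] := dsumE x.
by apply: (big_ind P) => // i _; apply: PI.
Qed.

(** The double sum is the Cauchy product: component n of an element of degree i + j is zero unless i
    + j = n, which selects the right pairs without transporting along this equation. *)
Fact dsum_mul_finite (x y : dsum V) : exists N, forall n, (N <= n)%N ->
  (fun n => \sum_(i < n.+1) \sum_(j < n.+1)
     (dsum_inj (mu (x i) (y j)) : dsum V) n) n = 0.
Proof.
have [M xM] := dsum_finite x; have [N yN] := dsum_finite y.
exists (M + N)%N => n MNn; apply: big1 => i _; apply: big1 => j _.
have [iM|Mi] := ltnP i M; last by rewrite xM // (linear_fun0 (mu_linearl _)) dsum_inj0.
have [jN|Nj] := ltnP j N; last by rewrite yN // (linear_fun0 (mu_linearr _)) dsum_inj0.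
rewrite /= dfwith_out // ltn_eqF // (leq_trans _ MNn) // -addSn.
by rewrite leq_add // ltnW.
Qed.

Definition dsum_mul (x y : dsum V) : dsum V := DSum (dsum_mul_finite x y).

Lemma dsum_mul_linearl y : linear (dsum_mul^~ y).
Proof.
move=> c x x'; apply: dsumP => n /=; rewrite scaler_sumr -big_split /=.
apply: eq_bigr => i _; rewrite scaler_sumr -big_split /=.
apply: eq_bigr => j _.
by rewrite mu_linearl; apply: (congr1 (fun z : dsum V => z n) (dsum_inj_linear _ _ _)).
Qed.

Lemma dsum_mul_linearr x : linear (dsum_mul x).
Proof.
move=> c y y'; apply: dsumP => n /=; rewrite scaler_sumr -big_split /=.
apply: eq_bigr => i _; rewrite scaler_sumr -big_split /=.
apply: eq_bigr => j _.
by rewrite mu_linearr; apply: (congr1 (fun z : dsum V => z n) (dsum_inj_linear _ _ _)).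
Qed.

Lemma dsum_mul_inj i j (u : V i) (v : V j) :
  dsum_mul (dsum_inj u) (dsum_inj v) = dsum_inj (mu u v).
Proof.
apply: dsumP => n; rewrite [LHS]/=.
have termE (k l : 'I_n.+1) : (dsum_inj (mu ((dsum_inj u : dsum V) k)
    ((dsum_inj v : dsum V) l)) : dsum V) n =
    if (k == i :> nat) && (l == j :> nat) then (dsum_inj (mu u v) : dsum V) n else 0.
  have [ki|ki] := eqVneq (k : nat) i; last first.
    by rewrite [dsum_fun _ k]/= dfwith_out 1?eq_sym // (linear_fun0 (mu_linearl _)) dsum_inj0.
  have [lj|lj] := eqVneq (l : nat) j; last first.
    by rewrite [dsum_fun (dsum_inj v) l]/= dfwith_out 1?eq_sym // (linear_fun0 (mu_linearr _)) dsum_inj0.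
  by rewrite /= ki lj !dfwith_in.
transitivity (\sum_(k < n.+1) \sum_(l < n.+1)
    if (k == i :> nat) && (l == j :> nat) then (dsum_inj (mu u v) : dsum V) n
    else 0).
  by apply: eq_bigr => k _; apply: eq_bigr => l _; apply: termE.
(* If i + j = n, both indices are at most n, so the pair occurs in the double sum; otherwise both
   sides are 0. *)
have [ijn|ijn] := eqVneq (i + j)%N n; last first.
  rewrite [RHS]/= dfwith_out // big1 // => k _; rewrite big1 // => l _.
  by case: ifP => // _; rewrite /= dfwith_out.
have lt_in : (i < n.+1)%N by rewrite ltnS -ijn leq_addr.
have lt_jn : (j < n.+1)%N by rewrite ltnS -ijn leq_addl.
rewrite (bigD1 (Ordinal lt_in)) //= [X in _ + X]big1 ?addr0; last first.
  move=> k; rewrite -val_eqE /= => /negPf ki.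
  by apply: big1 => l _; rewrite ki.
rewrite (bigD1 (Ordinal lt_jn)) //= [X in _ + X]big1 ?addr0 ?eqxx //.
by move=> l; rewrite -val_eqE /= => /negPf ->.
Qed.

(** Both sides are additive in each argument, which reduces the claim to homogeneous elements and
    [muA]. *)
Lemma dsum_mulA : associative dsum_mul.
Proof.
move=> x y z.
elim/dsum_ind: x => [|x x' IHx IHx'|i u].
- by rewrite !(linear_fun0 (dsum_mul_linearl _)).
- by rewrite !(linear_funD (dsum_mul_linearl _)) IHx IHx'.
elim/dsum_ind: y => [|y y' IHy IHy'|j v].
- rewrite (linear_fun0 (dsum_mul_linearl _)) (linear_fun0 (dsum_mul_linearr _)).
  by rewrite (linear_fun0 (dsum_mul_linearl _)).
- rewrite (linear_funD (dsum_mul_linearl _)) !(linear_funD (dsum_mul_linearr _)).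
  by rewrite (linear_funD (dsum_mul_linearl _)) IHy IHy'.
elim/dsum_ind: z => [|z z' IHz IHz'|k w].
- by rewrite !(linear_fun0 (dsum_mul_linearr _)).
- by rewrite !(linear_funD (dsum_mul_linearr _)) IHz IHz'.
by rewrite !dsum_mul_inj muA.
Qed.

Lemma dsum_mul_graded : graded_assoc_alg dsum_mul.
Proof.
split=> [y|x||i j u v].
- exact: dsum_mul_linearl.
- exact: dsum_mul_linearr.
- exact: dsum_mulA.
- by exists (mu u v); apply: dsum_mul_inj.
Qed.

End GradedProduct.

Theorem proposition4p1 (C : closedFieldType) (charC : [pchar C] =i pred0)
    (A : confAlgType C) :
  exists mul : dsum (HH A) -> dsum (HH A) -> dsum (HH A),
    graded_assoc_alg mul /\
    forall (m n : nat) (f : hker A m) (g : hker A n),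
      exists fg : cup f g \in @cocycle C A (m + n),
        mul (dsum_inj (HHclass f)) (dsum_inj (HHclass g)) =
        dsum_inj (HHclass (HKer fg)).
Proof.
(* The product extends [HHcup] biadditively; on classes of given cocycles, [HHcup_class] removes the
   chosen representatives. *)
exists (dsum_mul (HHcup_linearl charC) (HHcup_linearr charC)); split.
  by apply: dsum_mul_graded; apply: HHcupA.
move=> m n f g; exists (cup_cocycle charC (hker_cocycle f) (hker_cocycle g)).
by rewrite dsum_mul_inj HHcup_class.
Qed.
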